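(* For the following household $\mathsf{H}_1$, the optimal investment decision $\{I_1^*(t)\}_{t\in[0,T]}$ and the optimal consumption decision $\{C_1^*(t)\}_{t\in[0,T]}$ in the problem $$\sup_{\{I_1(t)\},\{C_1(t)\}}J(I_1,C_1)$$ described in the context are given by $$I_1^*(t)=\frac{\eta\alpha_2\sigma^2e^{(2-\rho)r(T-t)}+\theta}{\eta\alpha_1\sigma^2e^{(2-\rho)r(T-t)}+\theta}\cdot\bar I_2(t)\quad\text{and}\quad C_1^*(t)=\frac{1-\rho}{\beta_1}\,rt+k_1^*,$$ respectively, where the parameter $k_1^*$ is given by $$k_1^*=\left(\frac{\beta_1}{\alpha_1}+\frac{e^{rT}-1}{r}\right)^{-1}\left\{-rT+x_1e^{rT}+\frac{\ln\gamma_1}{\alpha_1}+\frac{v^2T}{2\alpha_1\sigma^2}+\frac{(\rho-1)(e^{rT}-rT-1)}{\beta_1r}-\frac{\alpha_1\sigma^2}{2}\int_0^Te^{2r(T-t)}[I_1^*(t)-\bar I_1(t)]^2\,dt\right\},$$ and the parameter $\eta$ is given by $$\eta=\exp\left\{-\alpha_1x_1e^{rT}-\alpha_1\int_0^Te^{r(T-t)}[vI_1^*(t)-C_1^*(t)]\,dt+\frac{\alpha_1^2\sigma^2}{2}\int_0^Te^{2r(T-t)}I_1^{*}(t)^2\,dt\right\}.$$ Here $\bar I_i(t)=\frac{v}{\alpha_i\sigma^2}e^{r(t-T)}$ for $i=1,2$.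
   Context: The financial market consists of one risk-free asset with interest rate $r$ and one risky asset with excess return rate $v$ and volatility $\sigma$; the time horizon is $[0,T]$. Let $\{B(t)\}_{t\in[0,T]}$ be a standard Brownian motion on a complete filtered probability space. There are two households: a leading household $\mathsf{H}_2$ with risk aversion coefficient $\alpha_2>0$, and a following household $\mathsf{H}_1$, whose investment is influenced by that of $\mathsf{H}_2$. The function $\bar I_2$ is the optimal investment decision of the leading household, and $\bar I_1$ is the rational investment decision of the following household (its optimal investment decision in the absence of herding). The following household chooses an investment decision $\{I_1(t)\}_{t\in[0,T]}$ (the fund allocated to the risky asset, with no restriction on its sign) and a consumption decision $\{C_1(t)\}_{t\in[0,T]}$ (assumed to be always positive). Its fund process satisfies $$dX_1(t)=[rX_1(t)+vI_1(t)-C_1(t)]\,dt+\sigma I_1(t)\,dB(t),\qquad X_1(0)=x_1,$$ where $x_1$ is the initial fund. The objective functional to be maximized is $$J(I_1,C_1)=\bar J(I_1,C_1)-\theta D(I_1,I_2),\qquad \bar J(I_1,C_1)=\mathbb{E}\,\phi_1[X_1(T)]+\gamma_1\int_0^T\psi_1[t,C_1(t)]\,dt,$$ with fund utility $\phi_1[X_1(T)]=-\frac{1}{\alpha_1}e^{-\alpha_1X_1(T)}$, consumption utility $\psi_1[t,C_1(t)]=-\frac{1}{\beta_1}e^{-\rho rt-\beta_1C_1(t)}$, and average deviation $$D(I_1,I_2)=\frac12\int_0^Te^{\rho r(T-t)}[I_1(t)-I_2(t)]^2\,dt,$$ where the leading household's investment decision is $I_2=\bar I_2$. Here $\alpha_1>0$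 is the risk aversion coefficient, $\beta_1>0$ the diminishing marginal coefficient, $\gamma_1>0$ the consumption weight coefficient, $\rho>0$ the decay coefficient, and $\theta\ge0$ the herd coefficient. The formulas for $I_1^*$, $C_1^*$, $k_1^*$ and $\eta$ form a coupled system.
   Formalization: The first term in the braces of k_1^* is corrected from -rT to -rT/alpha_1 (the printed term is wrong unless alpha_1=1), and C_1^* is required to be positive on [0,T], as otherwise it is not an admissible consumption decision. *)

(* Defs.v *)
From HB Require Import structures.
From mathcomp Require Import all_boot all_order all_algebra.
From mathcomp Require Import all_classical all_reals all_analysis.
Import Order.TTheory GRing.Theory Num.Theory.
Import numFieldNormedType.Exports.

Set Implicit Arguments.
Unset Strict Implicit.
Unset Printing Implicit Defensive.

Local Open Scope classical_set_scope.
Local Open Scope ring_scope.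

Section brownian_motion.
Context d (Omega : measurableType d) (R : realType) (P : probability Omega R).
Variable T : R.

(* Completeness of the space and of the filtration is the last clause: every
   subset of a null event belongs to F 0, hence is an event. *)
Definition complete_filtration (F : R -> set (set Omega)) : Prop :=
  [/\ forall t, 0 <= t <= T -> sigma_algebra setT (F t),
      forall t, 0 <= t <= T -> F t `<=` measurable,
      forall s t, 0 <= s -> s <= t -> t <= T -> F s `<=` F t &
      forall N, P.-negligible N -> F 0 N].

Definition adapted (F : R -> set (set Omega)) (X : R -> Omega -> R) : Prop :=
  forall t, 0 <= t <= T -> forall U : set R, measurable U -> F t (X t @^-1` U).

Definition continuous_paths (X : R -> Omega -> R) : Prop :=
  {ae P, forall w, {within `[0, T], continuous (fun t => X t w)}}.

(* The second parameter of normal_prob is the standard deviation. *)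
Definition brownian_motion (F : R -> set (set Omega)) (B : R -> Omega -> R)
    : Prop :=
  [/\ adapted F B,
      {ae P, forall w, B 0 w = 0},
      continuous_paths B,
      forall s t, 0 <= s -> s < t -> t <= T -> forall U : set R, measurable U ->
        P ((B t \- B s) @^-1` U) = normal_prob 0 (Num.sqrt (t - s)) U &
      forall s t, 0 <= s -> s < t -> t <= T ->
        forall (A : set Omega) (U : set R), F s A -> measurable U ->
        P (A `&` (B t \- B s)%R @^-1` U) = (P A * P ((B t \- B s)%R @^-1` U))%E].

(* The triples (a, s, u) of the list g encode the step function that is the
   sum of the a 1_(]s, u]); the intervals may overlap. *)
Definition step_fun (g : seq (R * R * R)) (x : R) : R :=
  \sum_(p <- g) (let: (a, s, u) := p in a * \1_`]s, u] x).

Definition step_wf (t : R) (g : seq (R * R * R)) : Prop :=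
  forall a s u, (a, s, u) \in g -> [/\ 0 <= s, s <= u & u <= t].

Definition step_ito (B : R -> Omega -> R) (g : seq (R * R * R)) (w : Omega)
    : R :=
  \sum_(p <- g) (let: (a, s, u) := p in a * (B u w - B s w)).

(* Y is the Ito integral over [0, t] with respect to B of the deterministic
   integrand f: the L^2(P)-limit of the integrals of step functions that
   converge to f in L^2([0, t]).  By the Ito isometry Y is unique a.s. and does
   not depend on the approximating sequence. *)
Definition ito_integral (B : R -> Omega -> R) (t : R) (f : R -> R)
    (Y : Omega -> R) : Prop :=
  measurable_fun setT Y /\
  exists g : nat -> seq (R * R * R),
    [/\ forall n, step_wf t (g n),
        (\int[lebesgue_measure]_(x in `[0%R, t])
            ((step_fun (g n) x - f x) ^+ 2)%:E)%E @[n --> \oo] --> 0%E &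
        'E_P[(fun w => (Y w - step_ito B (g n) w) ^+ 2)%R]%E @[n --> \oo] --> 0%E].

End brownian_motion.

Record model (R : realType) := Model {
  rate : R;        (* r *)
  excess : R;      (* v *)
  volatility : R;  (* sigma *)
  horizon : R;     (* T *)
  fund0 : R;       (* x_1 *)
  risk1 : R;       (* alpha_1 *)
  risk2 : R;       (* alpha_2 *)
  diminish : R;    (* beta_1 *)
  weight : R;      (* gamma_1 *)
  decay : R;       (* rho *)
  herd : R         (* theta *)
}.

Section following_household.
Context (R : realType) (m : model R).
Local Notation r := (rate m).
Local Notation v := (excess m).
Local Notation sigma := (volatility m).
Local Notation T := (horizon m).
Local Notation x1 := (fund0 m).
Local Notation alpha1 := (risk1 m).
Local Notation alpha2 := (risk2 m).
Local Notation beta1 := (diminish m).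
Local Notation gamma1 := (weight m).
Local Notation rho := (decay m).
Local Notation theta := (herd m).
Local Notation leb := (@lebesgue_measure R).

Definition rational_investment (alpha t : R) : R :=
  v / (alpha * sigma ^+ 2) * expR (r * (t - T)).

Definition fund_utility (x : R) : R := - alpha1^-1 * expR (- alpha1 * x).

Definition consumption_utility (t c : R) : R :=
  - beta1^-1 * expR (- rho * r * t - beta1 * c).

Definition average_deviation (I1 I2 : R -> R) : R :=
  2^-1 * \int[leb]_(t in `[0, T])
           (expR (rho * r * (T - t)) * (I1 t - I2 t) ^+ 2).

(* Decisions are deterministic functions of time: the objective takes no
   expectation of the consumption and deviation terms. *)
Definition admissible (I1 C1 : R -> R) : Prop :=
  [/\ measurable_fun `[0, T] I1,
      leb.-integrable `[0, T] (fun t => (I1 t ^+ 2)%:E),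
      leb.-integrable `[0, T] (EFin \o C1) &
      forall t, 0 <= t <= T -> 0 < C1 t].

Section stochastic.
Context d (Omega : measurableType d) (P : probability Omega R).
Variables (F : R -> set (set Omega)) (B : R -> Omega -> R).

Definition fund_process (I1 C1 : R -> R) (X : R -> Omega -> R) : Prop :=
  [/\ adapted T F X, continuous_paths P T X &
      exists2 M : R -> Omega -> R,
        forall t, 0 <= t <= T ->
          ito_integral P B t (fun s => sigma * I1 s) (M t) &
        {ae P, forall w, forall t, 0 <= t <= T ->
          X t w = x1 + \int[leb]_(s in `[0, t])
                         (r * X s w + v * I1 s - C1 s) + M t w}].

Definition objective (I1 C1 : R -> R) (X : R -> Omega -> R) : \bar R :=
  ('E_P[fun w => fund_utility (X T w)] +
   (gamma1 * \int[leb]_(t in `[0, T]) (consumption_utility t (C1 t))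
    - theta * average_deviation I1 (rational_investment alpha2))%:E)%E.

(* The fund process of a decision, hence the value J, is unique up to
   indistinguishability; J is introduced as a relation for lack of a canonical
   choice of that process. *)
Definition objective_value (I1 C1 : R -> R) (J : \bar R) : Prop :=
  admissible I1 C1 /\
  exists2 X, fund_process I1 C1 X & J = objective I1 C1 X.

Definition optimal (I1 C1 : R -> R) : Prop :=
  exists2 J, objective_value I1 C1 J &
    forall I1' C1' J', objective_value I1' C1' J' -> (J' <= J)%E.

End stochastic.

Definition optimal_investment (eta t : R) : R :=
  (eta * alpha2 * sigma ^+ 2 * expR ((2 - rho) * r * (T - t)) + theta) /
  (eta * alpha1 * sigma ^+ 2 * expR ((2 - rho) * r * (T - t)) + theta) *
  rational_investment alpha2 t.

Definition optimal_consumption (k t : R) : R :=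
  (1 - rho) / beta1 * r * t + k.

(* The first term is - rT / alpha1, as the first-order condition
     eta e^(r(T - t)) = gamma1 e^(- rho r t - beta1 C(t))
   requires: it gives beta1 k = ln gamma1 - ln eta - rT, and dividing by alpha1
   yields the formula.  The statement as originally published has - rT there, a
   misprint: the resulting decision is optimal only for alpha1 = 1. *)
Definition k_formula (eta : R) : R :=
  (beta1 / alpha1 + (expR (r * T) - 1) / r)^-1 *
  (- (r * T / alpha1) + x1 * expR (r * T) + ln gamma1 / alpha1
   + v ^+ 2 * T / (2 * alpha1 * sigma ^+ 2)
   + (rho - 1) * (expR (r * T) - r * T - 1) / (beta1 * r)
   - alpha1 * sigma ^+ 2 / 2 *
     \int[leb]_(t in `[0, T]) (expR (2 * r * (T - t)) *
        (optimal_investment eta t - rational_investment alpha1 t) ^+ 2)).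

Definition eta_formula (k eta : R) : R :=
  expR (- alpha1 * x1 * expR (r * T)
   - alpha1 * \int[leb]_(t in `[0, T]) (expR (r * (T - t)) *
        (v * optimal_investment eta t - optimal_consumption k t))
   + alpha1 ^+ 2 * sigma ^+ 2 / 2 *
     \int[leb]_(t in `[0, T]) (expR (2 * r * (T - t)) *
        optimal_investment eta t ^+ 2)).

Definition coupled_system (k eta : R) : Prop :=
  k = k_formula eta /\ eta = eta_formula k eta.

End following_household.

(* Main.v *)
Require Import Defs.
From mathcomp Require Import all_boot all_order all_algebra.
From mathcomp Require Import all_classical all_reals all_analysis.
From mathcomp Require Import measurable_realfun lebesgue_measure.
From mathcomp Require Import ring lra.
Import Order.TTheory GRing.Theory Num.Theory.
Import numFieldNormedType.Exports.
Local Open Scope classical_set_scope.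
Local Open Scope ring_scope.

Set Implicit Arguments.
Unset Strict Implicit.
Unset Printing Implicit Defensive.

(* With deterministic decisions the terminal fund is Gaussian, of which only the
   moment E exp(c X_T) = exp(c mean + c^2 var / 2) is needed.  It holds for
   Ito integrals of step functions by independence of the increments, and passes
   to limits S_n --> Z by applying Fatou's lemma to exp S_n and to
   exp(2 S_n - S_m): the convexity bound 2 e^S <= e^Z + e^(2S - Z) turns the two
   inequalities into an equality.  No Ito formula is used: summing by parts the
   discounted equation along a mesh exhibits X_T - mean as an almost sure limit
   of step integrals, and the fund process of a C^1 investment is built pathwise,
   its stochastic integral being integrated by parts.

   The objective is then a concave functional of (I, C).  Bounding the exponential
   below by its tangent at the optimal exponent ln eta leaves an integral that is
   maximised pointwise, with a strictly positive remainder away from the solution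
   of the first-order conditions, that is, of the coupled system.  Substituting
   the formula for k, the system reduces to one equation in ln eta, a bounded
   continuous perturbation of a linear function with positive slope, hence
   solvable by the intermediate value theorem. *)

(** * Exponential moments of step integrals *)

(** [ito_integral] determines each [M t] separately and only up to a null set, so the noise cannot
    be integrated in time along a path. The discounted equation is therefore used at the finitely
    many times of a mesh, and the combination of noises on the n-th mesh is approximated with error
    2^-(n+1): the errors are summable, which gives almost sure convergence without passing to
    subsequences. Conversely, a fund process has to be produced for the candidate decision alone,
    since every competitor in [optimal] comes with its own; the candidate investment is a smooth
    function of time, so a construction restricted to C^1 investments is enough. The tangent is that
    of x |-> e^x / alpha1, with slope eta / alpha1 at ln eta. As the exponent is - alpha1 times the
    mean plus alpha1^2 / 2 times the variance, both of them time integrals, the coupling of all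
    times through the terminal fund is reduced to the single multiplier eta. That multiplier is
    determined by the candidate itself, which is why the solution is a coupled system and not a
    formula. *)

Section normal_mgf.
Context {R : realType}.
Notation mu := (@lebesgue_measure R).

(** The Radon-Nikodym derivative of [normal_prob] and the density [normal_pdf] have the same
    integral over every measurable set, hence agree almost everywhere. *)
Lemma ge0_integral_normal_prob (m s : R) (f : R -> \bar R) :
  s != 0 -> measurable_fun setT f -> (forall x, (0 <= f x)%E) ->
  (\int[normal_prob m s]_x f x = \int[mu]_x (f x * (normal_pdf m s x)%:E))%E.
Proof.
move=> s0 mf f0.
have dom := normal_prob_dominates m s.
rewrite -(Radon_Nikodym_SigmaFinite.change_of_variables dom f0 measurableT mf).
have mg : measurable_fun setT (Radon_Nikodym_SigmaFinite.f (normal_prob m s) mu).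
  exact: measurable_int (Radon_Nikodym_SigmaFinite.f_integrable dom).
have mp : measurable_fun setT (fun x => (normal_pdf m s x)%:E).
  by apply/measurable_EFinP; exact: measurable_normal_pdf.
apply: ae_eq_integral => //; [exact: emeasurable_funM..|].
have : ae_eq mu setT (Radon_Nikodym_SigmaFinite.f (normal_prob m s) mu)
    (fun x => (normal_pdf m s x)%:E).
  apply: integral_ae_eq => //; first exact: Radon_Nikodym_SigmaFinite.f_integrable.
  by move=> A _ mA; rewrite -Radon_Nikodym_SigmaFinite.f_integral.
by apply: filterS => x /= /[apply] ->.
Qed.

Lemma normal_mgf (c s : R) : 0 < s ->
  (\int[normal_prob 0 s]_x (expR (c * x))%:E = (expR (c ^+ 2 * s ^+ 2 / 2))%:E)%E.
Proof.
move=> s0; have s1 : s != 0 by rewrite gt_eqF.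
rewrite ge0_integral_normal_prob//; last first.
  by apply/measurable_EFinP; apply: measurableT_comp => //; exact: measurable_funM.
(* Completing the square: tilting the centred density by e^(cx) gives, up to a constant factor, the
   density of mean c s^2. *)
transitivity (\int[mu]_x ((expR (c ^+ 2 * s ^+ 2 / 2))%:E *
    (normal_pdf (c * s ^+ 2) s x)%:E)%E)%E.
  apply: eq_integral => x _; rewrite -!EFinM !normal_pdfE// /normal_fun.
  by congr (_%:E); rewrite mulrCA [RHS]mulrCA -!expRD; congr (_ * expR _); field.
rewrite ge0_integralZl//.
- by rewrite integral_normal_pdf mule1.
- by apply/measurable_EFinP; exact: measurable_normal_pdf.
- by move=> x _; rewrite lee_fin normal_pdf_ge0.
Qed.

End normal_mgf.

Section independence.
Context d d1 d2 (Omega : measurableType d) (T1 : measurableType d1)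
  (T2 : measurableType d2) (R : realType) (P : probability Omega R).
Local Open Scope ereal_scope.

(** Independence says that the joint law agrees with the product of the marginals on rectangles,
    hence everywhere by uniqueness of the product measure; Tonelli's theorem does the rest. *)
Lemma ge0_integral_indep (X : Omega -> T1) (Y : Omega -> T2)
    (f : T1 -> \bar R) (g : T2 -> \bar R) :
  measurable_fun setT X -> measurable_fun setT Y ->
  (forall U V, measurable U -> measurable V ->
     P (X @^-1` U `&` Y @^-1` V) = P (X @^-1` U) * P (Y @^-1` V)) ->
  measurable_fun setT f -> (forall x, 0 <= f x) ->
  measurable_fun setT g -> (forall x, 0 <= g x) ->
  \int[P]_w (f (X w) * g (Y w)) = \int[P]_w f (X w) * \int[P]_w g (Y w).
Proof.
move=> mX mY XY mf f0 mg g0.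
pose X' : {mfun Omega >-> T1} := mfun_Sub (mem_set mX).
pose Y' : {mfun Omega >-> T2} := mfun_Sub (mem_set mY).
have mXY : measurable_fun setT (fun w => (X' w, Y' w)) by exact/measurable_fun_pair.
pose XY' : {mfun Omega >-> (T1 * T2)%type} := mfun_Sub (mem_set mXY).
pose h (z : T1 * T2) := f z.1 * g z.2.
have mh : measurable_fun setT h.
  by apply: emeasurable_funM; [exact: (measurableT_comp mf)|exact: (measurableT_comp mg)].
have h0 z : 0 <= h z by rewrite mule_ge0.
transitivity (\int[distribution P XY']_z h z).
  by rewrite ge0_integral_distribution.
transitivity (\int[distribution P X' \x distribution P Y']_z h z).
  apply: eq_measure_integral => /= A mA _.
  exact/esym/product_measure_unique.
rewrite fubini_tonelli1//.
transitivity (\int[distribution P X']_x (f x * \int[distribution P Y']_y g y)).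
  by apply: eq_integral => x _; rewrite -ge0_integralZl.
rewrite ge0_integralZr// ?integral_ge0//.
by rewrite !ge0_integral_distribution.
Qed.

End independence.

Section sub_sigma_algebra.
Context d (Omega : measurableType d) (R : realType).
Implicit Type (G : set (set Omega)) (X : Omega -> R).

(** The filtration consists of sets of events and not of measurable types, whence the formulation by
    preimages. [measurable_wrtP] passes to the generated sigma-algebra, where the closure properties
    of measurable functions are available. *)
Definition measurable_wrt G X := forall U : set R, measurable U -> G (X @^-1` U).

Lemma measurable_wrtP G X : sigma_algebra setT G -> measurable_wrt G X <->
  measurable_fun setT (X : g_sigma_algebraType G -> R).
Proof.
move=> sG; have GE : <<s G>> = G by rewrite smallest_id//.
split => [GX _ U mU|mX U mU].
- by rewrite setTI /measurable/= GE; exact: GX.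
- by have := mX measurableT _ mU; rewrite setTI /measurable/= GE.
Qed.

Lemma measurable_wrt_fun G X : G `<=` measurable ->
  measurable_wrt G X -> measurable_fun setT X.
Proof. by move=> GM GX _ U mU; rewrite setTI; exact/GM/GX. Qed.

Lemma measurable_wrt_sub G G' X : G `<=` G' ->
  measurable_wrt G X -> measurable_wrt G' X.
Proof. by move=> GG' GX U mU; exact/GG'/GX. Qed.

Lemma measurable_wrt_cst G (c : R) : sigma_algebra setT G -> measurable_wrt G (cst c).
Proof. by move=> sG; apply/measurable_wrtP. Qed.

Lemma measurable_wrtD G X Y : sigma_algebra setT G ->
  measurable_wrt G X -> measurable_wrt G Y ->
  measurable_wrt G (fun w => X w + Y w).
Proof.
move=> sG /(measurable_wrtP _ sG) GX /(measurable_wrtP _ sG) GY.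
exact/(measurable_wrtP _ sG)/measurable_funD.
Qed.

Lemma measurable_wrtM G X Y : sigma_algebra setT G ->
  measurable_wrt G X -> measurable_wrt G Y ->
  measurable_wrt G (fun w => X w * Y w).
Proof.
move=> sG /(measurable_wrtP _ sG) GX /(measurable_wrtP _ sG) GY.
exact/(measurable_wrtP _ sG)/measurable_funM.
Qed.

Lemma measurable_wrtZ G (c : R) X : sigma_algebra setT G ->
  measurable_wrt G X -> measurable_wrt G (fun w => c * X w).
Proof. by move=> sG GX; apply: measurable_wrtM => //; exact: measurable_wrt_cst. Qed.

Lemma measurable_wrt_sum G (I : eqType) (r : seq I) (X : I -> Omega -> R) :
  sigma_algebra setT G -> (forall i, i \in r -> measurable_wrt G (X i)) ->
  measurable_wrt G (fun w => \sum_(i <- r) X i w).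
Proof.
move=> sG; elim: r => [_|i r IH GX].
  by under eq_fun do rewrite big_nil; exact: measurable_wrt_cst.
under eq_fun do rewrite big_cons.
apply: measurable_wrtD => //; first by apply: GX; rewrite mem_head.
by apply: IH => j jr; apply: GX; rewrite inE jr orbT.
Qed.

End sub_sigma_algebra.

Section step_mgf.
Context d (Omega : measurableType d) (R : realType) (P : probability Omega R).
Variables (T : R) (F : R -> set (set Omega)) (B : R -> Omega -> R).
Hypothesis hF : complete_filtration P T F.
Hypothesis hB : brownian_motion P T F B.
Notation mu := (@lebesgue_measure R).

Lemma filtration_sigma_algebra t : 0 <= t <= T -> sigma_algebra setT (F t).
Proof. by case: hF => + _ _ _; apply. Qed.

Lemma adapted_measurable X t : adapted T F X -> 0 <= t <= T ->
  measurable_fun setT (X t).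
Proof.
move=> aX tT; apply: measurable_wrt_fun (aX t tT).
by case: hF => _ + _ _; apply.
Qed.

Lemma adapted_wrt X s t : adapted T F X -> 0 <= s -> s <= t -> t <= T ->
  measurable_wrt (F t) (X s).
Proof.
move=> aX s0 st tT; apply: measurable_wrt_sub (aX s _).
  by case: hF => _ _ + _; apply.
by rewrite s0 (le_trans st tT).
Qed.

Lemma integral_probability_cst (c : R) : (\int[P]_w c%:E = c%:E)%E.
Proof. by rewrite integral_cst// -[RHS]mule1; congr (_ * _)%E; exact: probability_setT. Qed.

Lemma bm_adapted : adapted T F B. Proof. by case: hB. Qed.

Lemma bm_increment_mgf c s t : 0 <= s -> s < t -> t <= T ->
  (\int[P]_w (expR (c * (B t w - B s w)))%:E = (expR (c ^+ 2 * (t - s) / 2))%:E)%E.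
Proof.
move=> s0 st tT; have t0 := le_trans s0 (ltW st).
have mBB : measurable_fun setT (B t \- B s).
  by apply: measurable_funB; apply: (adapted_measurable bm_adapted); lra.
have sts : 0 < Num.sqrt (t - s) by rewrite sqrtr_gt0 subr_gt0.
have := normal_mgf c sts; rewrite sqr_sqrtr ?subr_ge0 ?ltW// => <-.
pose D := @mfun_Sub _ _ Omega (measurableTypeR R) _ (mem_set mBB).
transitivity (\int[distribution P D]_x (expR (c * x))%:E)%E.
  rewrite ge0_integral_distribution//.
  by apply/measurable_EFinP; apply: measurableT_comp => //; exact: measurable_funM.
apply: (@eq_measure_integral _ _ _ _ (normal_prob 0 (Num.sqrt (t - s)))) => U mU _.
by case: hB => _ _ _ + _; apply.
Qed.

(** The increment is independent of [F s], so the expectation factors. The case s = t is separate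
    because [brownian_motion] prescribes the increments for s < t only. *)
Lemma bm_mgf_step c s t (X : Omega -> R) : 0 <= s -> s <= t -> t <= T ->
  measurable_wrt (F s) X ->
  (\int[P]_w (expR (X w + c * (B t w - B s w)))%:E =
   \int[P]_w (expR (X w))%:E * (expR (c ^+ 2 * (t - s) / 2))%:E)%E.
Proof.
move=> s0; rewrite le_eqVlt => /predU1P[<- sT FX|st tT FX].
  rewrite subrr mulr0 mul0r expR0 mule1.
  by apply: eq_integral => w _; rewrite subrr mulr0 addr0.
have t0 := le_trans s0 (ltW st).
rewrite -(bm_increment_mgf c s0 st tT).
pose Y w := B t w - B s w.
rewrite -(@ge0_integral_indep _ _ _ _ _ _ _ P X Y (fun x => (expR x)%:E)
  (fun x => (expR (c * x))%:E))//.
- by apply: eq_integral => w _; rewrite expRD.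
- apply: measurable_wrt_fun FX; case: hF => _ + _ _; apply.
  by rewrite s0/= ltW ?(lt_le_trans st).
- by apply: measurable_funB; apply: (adapted_measurable bm_adapted); lra.
- move=> U V mU mV; case: hB => _ _ _ _; apply => //.
  exact: FX.
- by apply/measurable_EFinP.
- by apply/measurable_EFinP; apply: measurableT_comp => //; exact: measurable_funM.
Qed.

(* A step function is also a combination of the 1_(]0, t]), with integral the
   same combination of the B t: this form is the one adapted to induction on
   the times in decreasing order. *)
Let comb (l : seq (R * R)) (w : Omega) := \sum_(p <- l) p.1 * B p.2 w.
Let comb_fun (l : seq (R * R)) (x : R) := \sum_(p <- l) p.1 * \1_`]0, p.2] x.

(** In a list sorted by [later] the largest time comes first. [later (0, t)] also serves as the
    predicate that a time is at most [t], the amplitude 0 being a dummy. *)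
Let later (p q : R * R) := q.2 <= p.2.

Let measurable_wrt_comb t l : 0 <= t <= T ->
  (forall p, p \in l -> 0 <= p.2 <= t) -> measurable_wrt (F t) (comb l).
Proof.
move=> tT lt; have sF := filtration_sigma_algebra tT; have /andP[_ t1] := tT.
apply: measurable_wrt_sum => // p /lt/andP[p0 pt]; apply: measurable_wrtZ => //.
exact: adapted_wrt bm_adapted _ _ _.
Qed.

Let comb_fun_eq0 t l x : all (later (0, t)) l -> t < x -> comb_fun l x = 0.
Proof.
move=> /allP lt tx; rewrite /comb_fun big_seq big1// => p /lt; rewrite /later/= => pt.
rewrite indicE memNset ?mulr0//= in_itv/= => /andP[_].
by rewrite leNgt (le_lt_trans pt tx).
Qed.

Let measurable_comb_fun l : measurable_fun setT (comb_fun l).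
Proof.
by apply: measurable_sum => p; apply: measurable_funM => //; exact: measurable_indic.
Qed.

Let indic_itvoc_split (a b c x : R) : a <= b -> b <= c ->
  \1_`]a, c] x = \1_`]a, b] x + \1_`]b, c] x :> R.
Proof.
move=> ab bc; rewrite !indicE !mem_setE !in_itv/=.
case: (ltP a x) => ax; case: (leP x b) => xb; case: (leP x c) => xc /=; rewrite ?addr0 ?add0r//; lra.
Qed.

Let integral_indic_sqr c a b : 0 <= a -> a <= b -> b <= T ->
  (\int[mu]_(x in `[0%R, T]) ((c * \1_`]a, b] x) ^+ 2)%:E = (c ^+ 2 * (b - a))%:E)%E.
Proof.
move=> a0 ab bT.
under eq_integral do rewrite exprMn EFinM.
rewrite ge0_integralZl//; last 2 first.
- by apply/measurable_EFinP; apply: measurable_funX; exact: measurable_funTS.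
- by rewrite lee_fin sqr_ge0.
rewrite [RHS]EFinM; congr (_ * _)%E.
transitivity (\int[mu]_(x in `[0%R, T]) (\1_`]a, b] x)%:E)%E.
  by apply: eq_integral => x _; rewrite indicE -natrX; case: (_ \in _).
rewrite integral_indic// setIidl; last first.
  by move=> x /=; rewrite !in_itv/= => /andP[ax xb]; lra.
apply: etrans (lebesgue_measure_itv _) _; rewrite /= lte_fin -EFinD.
case: ltP => // ba.
by have -> : b = a by [lra]; rewrite subrr.
Qed.

(** Naming the real value [q] of the integral of the square records its finiteness, so the induction
    adds variances without [fine]. *)
Let mgf_spec (f : R -> R) (Z : Omega -> R) :=
  exists2 q : R, (\int[mu]_(x in `[0%R, T]) (f x ^+ 2)%:E = q%:E)%E &
    (\int[P]_w (expR (Z w))%:E = (expR (q / 2))%:E)%E.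

(** With t2 <= t1 the two latest terms recombine as c1 1_(]0, t1]) + c2 1_(]0, t2]) = (c1 + c2)
    1_(]0, t2]) + c1 1_(]t2, t1]). Everything but the last summand lives up to time t2 and is
    independent of the increment after t2. The merged list is not a sublist, hence the induction on
    the length. *)
Let comb_mgf_sorted l : path.sorted later l ->
  (forall p, p \in l -> 0 <= p.2 <= T) -> mgf_spec (comb_fun l) (comb l).
Proof.
have [n] := ubnP (size l); elim: n l => // n IH [|[c1 t1] [|[c2 t2] l]].
- move=> _ _ _; exists 0.
    by rewrite integral0_eq// => x _; rewrite /comb_fun big_nil expr0n.
  rewrite mul0r expR0 (eq_integral (fun=> 1%:E)); last first.
    by move=> w _; rewrite /comb big_nil expR0.
  exact: integral_probability_cst.
- move=> _ _ /(_ _ (mem_head _ _))/= /andP[t0 tT].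
  exists (c1 ^+ 2 * t1).
    under eq_integral do rewrite /comb_fun big_seq1/=.
    by rewrite integral_indic_sqr// subr0.
  have T0 := le_trans t0 tT.
  have F0 : measurable_wrt (F 0) (fun=> 0 : R) :=
    measurable_wrt_cst (0 : R) (filtration_sigma_algebra (introT andP (conj (lexx _) T0))).
  have := bm_mgf_step c1 (lexx 0) t0 tT F0; rewrite /=.
  rewrite expR0 integral_probability_cst !mul1e subr0 => <-.
  have mB t : 0 <= t <= T -> measurable_fun setT (B t).
    exact: adapted_measurable bm_adapted.
  have mBt := mB t1 (introT andP (conj t0 tT)).
  have mB0 := mB 0 (introT andP (conj (lexx 0) T0)).
  (* [B 0] vanishes only almost surely, so [c1 * B t1] is compared with the increment from 0 almost
     everywhere. *)
  apply: ge0_ae_eq_integral => //.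
  + apply/measurable_EFinP; apply: measurableT_comp => //.
    have t1T : 0 <= t1 <= T by rewrite t0.
    apply: (measurable_wrt_fun _ (measurable_wrt_comb t1T _)) => [|p].
      by case: hF => _ + _ _; apply.
    by rewrite inE => /eqP ->/=; rewrite t0 lexx.
  + apply/measurable_EFinP; apply: measurableT_comp => //.
    by apply: measurable_funD => //; apply: measurable_funM => //; exact: measurable_funB.
  + case: hB => _ + _ _ _; apply: filterS => w /= B0 _.
    by rewrite /comb big_seq1/= B0 subr0 add0r.
- move=> /= nl /andP[t21 sl] lT.
  have /=/andP[t10 t1T] := lT _ (mem_head _ _).
  have /=/andP[t20 t2T] : 0 <= (c2, t2).2 <= T by apply: lT; rewrite !inE eqxx orbT.
  have [||q Qq Pq] := IH ((c1 + c2, t2) :: l) nl.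
    by case: l sl {nl lT} => //= p l /andP[].
    move=> p; rewrite inE => /predU1P[->/=|pl]; first by rewrite t20.
    by apply: lT; rewrite !inE pl !orbT.
  have cfE x : comb_fun [:: (c1, t1), (c2, t2) & l] x =
      comb_fun ((c1 + c2, t2) :: l) x + c1 * \1_`]t2, t1] x.
    by rewrite /comb_fun !big_cons/= (@indic_itvoc_split 0 t2 t1)//; ring.
  (* The supports are disjoint: the cross term of the square disappears and the variances add. *)
  have disj x : comb_fun ((c1 + c2, t2) :: l) x * (c1 * \1_`]t2, t1] x) = 0.
    have [xt2|t2x] := leP x t2.
      by rewrite [\1__ _]indicE memNset ?mulr0//= in_itv/= ltNge xt2.
    rewrite (@comb_fun_eq0 t2) ?mul0r//= /later/= lexx/=.
    by apply: order_path_min sl => a b c; rewrite /later => ba ac; exact: le_trans ac ba.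
  exists (q + c1 ^+ 2 * (t1 - t2)).
    rewrite EFinD -Qq -(@integral_indic_sqr _ t2 t1)// -ge0_integralD//.
    + apply: eq_integral => x _; rewrite cfE -EFinD; congr (_%:E).
      by rewrite sqrrD disj mul0rn addr0.
    + by move=> x _; rewrite lee_fin sqr_ge0.
    + apply/measurable_EFinP; apply: measurable_funX; apply: measurable_funTS.
      exact: measurable_comb_fun.
    + by move=> x _; rewrite lee_fin sqr_ge0.
    + apply/measurable_EFinP; apply: measurable_funX; apply: measurable_funTS.
      exact: measurable_funM.
  rewrite mulrDl expRD EFinM -Pq -bm_mgf_step//.
    apply: eq_integral => w _; congr (expR _)%:E.
    by rewrite /comb !big_cons/=; ring.
  have st2 : all (later (0, t2)) ((c1 + c2, t2) :: l).
    rewrite /= /later/= lexx/=.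
    by apply: order_path_min sl => a b c; rewrite /later => ba ac; exact: le_trans ac ba.
  apply: measurable_wrt_comb => [|p pl]; first by rewrite t20.
  rewrite [X in _ && X](allP st2 _ pl) andbT.
  move: pl; rewrite inE => /predU1P[->//|pl].
  by have /andP[] : 0 <= p.2 <= T by apply: lT; rewrite !inE pl !orbT.
Qed.

Lemma step_ito_mgf g : step_wf T g ->
  (\int[P]_w (expR (step_ito B g w))%:E =
   (expR (2^-1 * \int[mu]_(x in `[0%R, T]) (step_fun g x ^+ 2)))%:E)%E.
Proof.
move=> wfg.
(* a 1_(]s, u]) is the difference of a 1_(]0, u]) and a 1_(]0, s]). *)
pose pairs (p : R * R * R) := [:: (p.1.1, p.2); (- p.1.1, p.1.2)].
pose l := flatten (map pairs g).
have lT p : p \in sort later l -> 0 <= p.2 <= T.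
  rewrite mem_sort => /flattenP[_ /mapP[[[a s] u] /wfg[s0 su uT] ->]].
  rewrite !inE => /orP[]/eqP -> /=; lra.
have tot : total later by move=> p q; exact: le_total.
have [q Qq Pq] := comb_mgf_sorted (sort_sorted tot l) lT.
have funE x : comb_fun (sort later l) x = step_fun g x.
  rewrite /comb_fun (perm_big _ (permEl (perm_sort _ _))) big_flatten/= big_map.
  rewrite /step_fun !big_seq; apply: eq_bigr => -[[a s] u] /wfg[s0 su uT].
  by rewrite big_cons big_seq1/= (indic_itvoc_split _ s0 su); ring.
have itoE w : comb (sort later l) w = step_ito B g w.
  rewrite /comb (perm_big _ (permEl (perm_sort _ _))) big_flatten/= big_map.
  rewrite /step_ito; apply: eq_bigr => -[[a s] u] _.
  by rewrite big_cons big_seq1/=; ring.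
under eq_integral do rewrite -itoE.
rewrite Pq /Rintegral.
under [X in fine X]eq_integral do rewrite -funE.
by rewrite Qq/= mulrC.
Qed.

End step_mgf.

(** * Exponential moments of limits of step integrals *)

Section limn_einf_lemmas.
Context {R : realType}.
Implicit Types u v : (\bar R)^nat.
Local Open Scope ereal_scope.

Lemma le_limn_einf u v : (forall n, u n <= v n) -> limn_einf u <= limn_einf v.
Proof.
move=> uv; rewrite !limn_einf_lim; apply: lee_lim; [exact: is_cvg_einfs..|].
apply: nearW => n; apply: le_ereal_inf_tmp => _ [k nk <-].
by apply: le_trans (uv k); apply: ereal_inf_lbound; exists k.
Qed.

Lemma limn_einf_ge0 u : (forall n, 0 <= u n) -> 0 <= limn_einf u.
Proof.
move=> u0; rewrite limn_einf_lim; apply: lime_ge; first exact: is_cvg_einfs.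
by apply: nearW => n; apply: le_ereal_inf_tmp => _ [k nk <-].
Qed.

End limn_einf_lemmas.

Section measure_lemmas.
Context d (X : measurableType d) (R : realType).
Variables (mu : {measure set X -> \bar R}) (D : set X).
Hypothesis mD : measurable D.

Lemma ae_fin_of_integral_fin (f : X -> \bar R) : measurable_fun D f ->
  (forall x, D x -> (0 <= f x)%E) -> (\int[mu]_(x in D) f x < +oo)%E ->
  {ae mu, forall x, D x -> (f x < +oo)%E}.
Proof.
move=> mf f0 foo.
have /(integrable_ae mD) : mu.-integrable D f.
  apply/integrableP; split => //.
  by under eq_integral => x /set_mem Dx do rewrite gee0_abs ?f0//.
by apply: filterS => x /[apply]; rewrite fin_numE -ltey => /andP[].
Qed.

(** The geometric bounds make the series of squares integrable, hence finite almost everywhere, and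
    the terms of a convergent series tend to 0. *)
Lemma ae_cvg0_of_summable_sqr (Y : nat -> X -> R) :
  (forall k, measurable_fun D (Y k)) ->
  (forall k, (\int[mu]_(x in D) (Y k x ^+ 2)%:E <= (2^-1 ^+ k.+1)%:E)%E) ->
  {ae mu, forall x, D x -> Y k x @[k --> \oo] --> 0}.
Proof.
move=> mY leY.
have mY2 k : measurable_fun D (fun x => (Y k x ^+ 2)%:E).
  by apply/measurable_EFinP; exact: measurable_funX.
have Y0 k x : D x -> (0 <= (Y k x ^+ 2)%:E)%E by rewrite lee_fin sqr_ge0.
have sumY : (\int[mu]_(x in D) \sum_(0 <= k <oo) (Y k x ^+ 2)%:E < +oo)%E.
  rewrite integral_nneseries//.
  apply: (@le_lt_trans _ _ (\sum_(0 <= k <oo) (1 / (2 ^ (k + 0.+1))%:R)%:E)%E).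
    apply: lee_nneseries => [k _ _|k _].
      by apply: integral_ge0 => x Dx; exact: Y0.
    by apply: le_trans (leY k) _; rewrite lee_fin addn1 div1r natrX -exprVn.
  by rewrite (cvg_lim _ (@cvg_geometric_eseries_half R 1 0))// ltry.
have : {ae mu, forall x, D x -> (\sum_(0 <= k <oo) (Y k x ^+ 2)%:E < +oo)%E}.
  apply: ae_fin_of_integral_fin => //.
    by apply: ge0_emeasurable_sum => // k x Dx _; exact: Y0.
  by move=> x Dx; apply: nneseries_ge0 => k _ _; exact: Y0.
apply: filterS => x h Dx.
have tail := nneseries_tail_cvg (h Dx) (fun k _ => Y0 k x Dx).
have Y20 : (Y k x ^+ 2)%:E @[k --> \oo] --> 0%E.
  apply: squeeze_cvge tail; last exact: cvg_cst.
  apply: nearW => k; rewrite lee_fin sqr_ge0/=.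
  rewrite (@nneseries_split _ _ k 1)//; last by move=> i _; rewrite lee_fin sqr_ge0.
  by rewrite addn1 big_nat1 leeDl// nneseries_ge0// => i _ _; rewrite lee_fin sqr_ge0.
have {}Y20 : Y k x ^+ 2 @[k --> \oo] --> 0 by apply: fine_cvg Y20.
apply/cvgr0Pnorm_lt => e e0; near=> k.
rewrite -(@ltr_pXn2r _ 2)// ?nnegrE// ?ltW//.
rewrite -normrX; near: k.
by apply: (cvgr0_norm_lt _ Y20); rewrite exprn_gt0.
Unshelve. all: by end_near. Qed.

(** Fatou's lemma in the form used for the limits of step integrals: real integrands, almost sure
    convergence, and convergent upper bounds in place of the integrals themselves. *)
Lemma fatou_le (f_ : nat -> X -> R) (f : X -> R) (c_ : nat -> R) (c : R) :
  (forall n, measurable_fun D (f_ n)) -> measurable_fun D f ->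
  (forall n x, D x -> 0 <= f_ n x) -> (forall x, D x -> 0 <= f x) ->
  (forall n, (\int[mu]_(x in D) (f_ n x)%:E <= (c_ n)%:E)%E) ->
  {ae mu, forall x, D x -> f_ n x @[n --> \oo] --> f x} ->
  c_ n @[n --> \oo] --> c ->
  (\int[mu]_(x in D) (f x)%:E <= c%:E)%E.
Proof.
move=> mf_ mf f_0 f0 lec f_f c_c.
have mf_E n : measurable_fun D (EFin \o f_ n) by exact/measurable_EFinP.
have ff n x : D x -> (0 <= (EFin \o f_ n) x)%E by move=> Dx; rewrite lee_fin f_0.
have lim_f : ae_eq mu D (fun x => (f x)%:E) (fun x => limn_einf (fun n => (f_ n x)%:E)).
  apply: filterS f_f => x h Dx; apply/esym.
  have [|-> //] := @cvg_limn_einf_sup _ (fun n => (f_ n x)%:E) (f x)%:E.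
  by apply: cvg_EFin; [exact: nearW|exact: h].
rewrite (ge0_ae_eq_integral mD _ _ _ _ lim_f)//; last 3 first.
- exact/measurable_EFinP.
- apply: (emeasurable_fun_cvg _ _ (measurable_fun_einfs mf_E)) => x Dx.
  by rewrite limn_einf_lim; exact: is_cvg_einfs.
- by move=> x Dx; rewrite limn_einf_ge0// => n; rewrite lee_fin f_0.
apply: le_trans (fatou mu mD mf_E ff) _.
apply: (@le_trans _ _ (limn_einf (fun n => (c_ n)%:E))).
  exact: le_limn_einf.
have [|-> //] := @cvg_limn_einf_sup _ (fun n => (c_ n)%:E) c%:E.
by apply: cvg_EFin; first exact: nearW.
Qed.

End measure_lemmas.

(** * Square-integrable functions and continuity of the squared norm *)

Section square_integrable.
Context d (X : measurableType d) (R : realType).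
Variables (mu : {measure set X -> \bar R}) (D : set X).
Hypothesis mD : measurable D.
Implicit Types f g : X -> R.

Definition square_integrable f :=
  measurable_fun D f /\ mu.-integrable D (fun x => (f x ^+ 2)%:E).

Lemma integrable_dominated f g : measurable_fun D f ->
  mu.-integrable D (EFin \o g) -> (forall x, D x -> `|f x| <= g x) ->
  mu.-integrable D (EFin \o f).
Proof.
move=> mf ig fg; apply: le_integrable ig => //; first exact/measurable_EFinP.
by move=> x Dx /=; rewrite lee_fin (le_trans (fg _ Dx))// ler_norm.
Qed.

Lemma square_integrableD f g : square_integrable f -> square_integrable g ->
  square_integrable (fun x => f x + g x).
Proof.
move=> [mf f2] [mg g2]; have mfg := measurable_funD mf mg; split => //.
apply: (@integrable_dominated _ (fun x => 2 * f x ^+ 2 + 2 * g x ^+ 2)).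
- exact: measurable_funX.
- have := integrableD mD (integrableZl mD 2 f2) (integrableZl mD 2 g2).
  by apply: eq_integrable.
- move=> x _; rewrite ger0_norm ?sqr_ge0//; have := sqr_ge0 (f x - g x); nra.
Qed.

Lemma square_integrableM f g (c : R) : measurable_fun D g ->
  (forall x, D x -> `|g x| <= c) -> square_integrable f ->
  square_integrable (fun x => g x * f x).
Proof.
move=> mg gc [mf f2]; have mfg := measurable_funM mg mf; split => //.
apply: (@integrable_dominated _ (fun x => c ^+ 2 * f x ^+ 2)).
- exact: measurable_funX.
- by have := integrableZl mD (c ^+ 2) f2; apply: eq_integrable.
- move=> x Dx; rewrite ger0_norm ?sqr_ge0// exprMn ler_wpM2r ?sqr_ge0//.
  by rewrite -[g x ^+ 2]ger0_norm ?sqr_ge0// normrX lerXn2r ?nnegrE ?gc// (le_trans _ (gc x Dx)).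
Qed.

Lemma square_integrableZ f (c : R) : square_integrable f ->
  square_integrable (fun x => c * f x).
Proof. by move=> f2; apply: (@square_integrableM _ (fun=> c) `|c|). Qed.

Lemma square_integrableB f g : square_integrable f -> square_integrable g ->
  square_integrable (fun x => f x - g x).
Proof.
move=> f2 g2; have := square_integrableD f2 (square_integrableZ (-1) g2).
by rewrite (_ : (fun x => _) = (fun x => f x - g x))//; apply/funext => x; rewrite mulN1r.
Qed.

Lemma square_integrable_sum (I : eqType) (r : seq I) (f : I -> X -> R) :
  (forall i, i \in r -> square_integrable (f i)) ->
  square_integrable (fun x => \sum_(i <- r) f i x).
Proof.
elim: r => [_|i r IH rf].
  rewrite (_ : (fun x => _) = (fun=> 0)); last by apply/funext => x; rewrite big_nil.
  split; first exact: measurable_cst.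
  rewrite (_ : (fun x => _) = (fun=> 0%E)); last by apply/funext => x; rewrite expr0n.
  exact: integrable0.
rewrite (_ : (fun x => _) = (fun x => f i x + \sum_(i <- r) f i x)); last first.
  by apply/funext => x; rewrite big_cons.
apply: square_integrableD; first by apply: rf; rewrite mem_head.
by apply: IH => j jr; apply: rf; rewrite inE jr orbT.
Qed.

Lemma integrable_mul f g : square_integrable f -> square_integrable g ->
  mu.-integrable D (EFin \o (fun x => f x * g x)).
Proof.
move=> [mf f2] [mg g2].
apply: (@integrable_dominated _ (fun x => f x ^+ 2 + g x ^+ 2)).
- exact: measurable_funM.
- by have := integrableD mD f2 g2; apply: eq_integrable.
- move=> x _; rewrite normrM -(real_normK (num_real (f x))) -(real_normK (num_real (g x))).
  by have := sqr_ge0 (`|f x| - `|g x|); have := sqr_ge0 `|f x|; have := sqr_ge0 `|g x|; nra.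
Qed.

Local Notation N f := (\int[mu]_(x in D) (f x ^+ 2)).

Lemma integral_sqr_ge0 f : 0 <= N f.
Proof. by apply: Rintegral_ge0 => x _; rewrite sqr_ge0. Qed.

Lemma integral_sqrD_le (c : R) f g : square_integrable f -> square_integrable g ->
  N (fun x => c * f x + g x) <= 2 * c ^+ 2 * N f + 2 * N g.
Proof.
move=> f2 g2; have [_ fg2] := square_integrableD (square_integrableZ c f2) g2.
have [_ if2] := f2; have [_ ig2] := g2.
have i1 := integrableZl mD (2 * c ^+ 2) if2; have i2 := integrableZl mD 2 ig2.
rewrite -RintegralZl// -[2 * N g]RintegralZl// -RintegralD//.
apply: le_Rintegral => //; first by have := integrableD mD i1 i2; apply: eq_integrable.
by move=> x _; have := sqr_ge0 (c * f x - g x); lra.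
Qed.

(** In a^2 - b^2 = (a - b)^2 + 2 (a - b) b the cross term is split by the weighted
    arithmetic-geometric inequality; the weight [e] stays free, to be chosen small before f - g
    is. *)
Lemma integral_sqr_diff_le f g e : square_integrable f -> square_integrable g ->
  0 < e -> `|N f - N g| <= (1 + e^-1) * \int[mu]_(x in D) ((f x - g x) ^+ 2) + e * N g.
Proof.
move=> f2 g2 e0; have [_ d2] := square_integrableB f2 g2.
have [mf if2] := f2; have [mg ig2] := g2.
rewrite -RintegralB//; have iB := integrableB mD if2 ig2.
apply: le_trans (le_normr_Rintegral mD _) _; first by apply: eq_integrable iB.
have i1 := integrableZl mD (1 + e^-1) d2; have i2 := integrableZl mD e ig2.
rewrite -RintegralZl// -[e * _]RintegralZl// -RintegralD//.
apply: le_Rintegral => //.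
- by apply: integrable_norm; apply: eq_integrable iB.
- by have := integrableD mD i1 i2; apply: eq_integrable.
move=> x _; set a := f x; set b := g x.
have eV : 0 < e^-1 by rewrite invr_gt0.
have AM : 2 * `|a - b| * `|b| <= e^-1 * (a - b) ^+ 2 + e * b ^+ 2.
  rewrite -(real_normK (num_real (a - b))) -(real_normK (num_real b)).
  rewrite -subr_ge0 (_ : _ - _ = e^-1 * (`|a - b| - e * `|b|) ^+ 2); last first.
    by field; rewrite gt_eqF.
  by rewrite mulr_ge0 ?sqr_ge0// ltW.
rewrite (_ : a ^+ 2 - b ^+ 2 = (a - b) ^+ 2 + 2 * (a - b) * b); last by ring.
apply: le_trans (ler_normD _ _) _; rewrite ger0_norm ?sqr_ge0//.
by rewrite !normrM ger0_norm//; lra.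
Qed.

Lemma cvg_integral_sqr (f_ : nat -> X -> R) f :
  (forall n, square_integrable (f_ n)) -> square_integrable f ->
  \int[mu]_(x in D) ((f_ n x - f x) ^+ 2) @[n --> \oo] --> 0 ->
  N (f_ n) @[n --> \oo] --> N f.
Proof.
move=> f_2 f2 f_f; apply/cvgrPdist_le => e e0.
(* With this weight [c * N f] is at most e / 2; the added 1 covers the case N f = 0. *)
pose c := e / (2 * (N f + 1)).
have N0 := integral_sqr_ge0 f.
have c0 : 0 < c by rewrite divr_gt0// mulr_gt0// ltr_wpDl.
have d0 : 0 < e / (2 * (1 + c^-1)) by rewrite divr_gt0// mulr_gt0// addr_gt0// invr_gt0.
near=> n; rewrite distrC; apply: le_trans (integral_sqr_diff_le (f_2 n) f2 c0) _.
have cN : c * N f <= e / 2.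
  rewrite /c invfM mulrA -mulrA ler_piMr ?divr_ge0 ?ltW//.
  by rewrite mulrC ltr_pdivrMr ?ltr_wpDl// mul1r ltrDl.
suff : (1 + c^-1) * \int[mu]_(x in D) ((f_ n x - f x) ^+ 2) <= e / 2 by lra.
rewrite mulrC -ler_pdivlMr ?addr_gt0 ?invr_gt0// -mulrA -invfM.
apply: le_trans (ler_norm _) _; apply: ltW; near: n.
exact: cvgr0_norm_lt f_f _ d0.
Unshelve. all: by end_near. Qed.

End square_integrable.

(** * Linear operations on step functions *)

Section step_functions.
Context {R : realType}.
Implicit Type g : seq (R * R * R).
Notation mu := (@lebesgue_measure R).

(** The intervals of a step list may overlap, so [++] is addition and no common refinement is
    formed; together with scaling it keeps linear combinations of step integrals within the reach of
    [step_ito_mgf]. *)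
Definition step_scale (c : R) g : seq (R * R * R) :=
  [seq (c * p.1.1, p.1.2, p.2) | p <- g].

Lemma step_wf_scale t c g : step_wf t g -> step_wf t (step_scale c g).
Proof. by move=> wg a s u /mapP[[[a' s'] u'] /wg ? [_ -> ->]]. Qed.

Lemma step_fun_scale c g x : step_fun (step_scale c g) x = c * step_fun g x.
Proof.
rewrite /step_fun big_map mulr_sumr; apply: eq_bigr => -[[a s] u] _ /=.
by rewrite mulrA.
Qed.

Lemma step_ito_scale d (Omega : measurableType d) (B : R -> Omega -> R) c g w :
  step_ito B (step_scale c g) w = c * step_ito B g w.
Proof.
rewrite /step_ito big_map mulr_sumr; apply: eq_bigr => -[[a s] u] _ /=.
by rewrite mulrA.
Qed.

Lemma step_wf_cat t g g' : step_wf t g -> step_wf t g' -> step_wf t (g ++ g').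
Proof. by move=> wg wg' a s u; rewrite mem_cat => /orP[/wg|/wg']. Qed.

Lemma step_fun_cat g g' x : step_fun (g ++ g') x = step_fun g x + step_fun g' x.
Proof. by rewrite /step_fun big_cat. Qed.

Lemma step_ito_cat d (Omega : measurableType d) (B : R -> Omega -> R) g g' w :
  step_ito B (g ++ g') w = step_ito B g w + step_ito B g' w.
Proof. by rewrite /step_ito big_cat. Qed.

Lemma step_wf_le t t' g : t <= t' -> step_wf t g -> step_wf t' g.
Proof. by move=> tt' wg a s u /wg[s0 su ut]; split => //; exact: le_trans tt'. Qed.

Lemma square_integrable_continuous (T : R) (f : R -> R) :
  {within `[0, T], continuous f} -> square_integrable mu `[0, T] f.
Proof.
move=> cf; split.
  exact: subspace_continuous_measurable_fun.
apply: continuous_compact_integrable; first exact: segment_compact.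
rewrite (_ : (fun x => _) = (fun x => f x * f x)); last first.
  by apply/funext => x; rewrite expr2.
by move=> x; apply: cvgM; exact: cf.
Qed.

Lemma square_integrable_indic (T t : R) (f : R -> R) :
  square_integrable mu `[0, T] f ->
  square_integrable mu `[0, T] (fun x : R => f x * \1_`[0, t] x).
Proof.
move=> f2; rewrite (_ : (fun x => _) = (fun x : R => \1_`[0, t] x * f x)); last first.
  by apply/funext => x; rewrite mulrC.
have mT : measurable (`[0, T]%classic : set (measurableTypeR R)) by exact: measurable_itv.
apply: (square_integrableM mT (g := \1_`[0, t]) (c := 1) _ _ f2) => //.
by move=> x _; rewrite indicE ger0_norm// lern1 leq_b1.
Qed.

Lemma step_fun_square_integrable T g : square_integrable mu `[0, T] (step_fun g).
Proof.
rewrite /step_fun; apply: square_integrable_sum => // -[[a s] u] _ /=.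
rewrite (_ : (fun x => _) = (fun x => \1_`]s, u] x * a)); last first.
  by apply/funext => x; rewrite mulrC.
apply: (@square_integrableM _ _ _ _ _ _ (fun=> a) _ 1) => //.
- by move=> x _; rewrite indicE ger0_norm// lern1 leq_b1.
- by apply: square_integrable_continuous; apply: continuous_subspaceT; exact: cst_continuous.
Qed.

End step_functions.

(** For y = x / 2 one has e^x + e^(-x) - 2 = (e^y - e^(-y))^2, and e^y - e^(-y) >= y when y >= 0;
    the factor 4 undoes the halving. Through this bound exponential moments control second
    moments. *)
Lemma sqr_le_expR {R : realType} (x : R) :
  x ^+ 2 + 8 <= 4 * (expR x + expR (- x)).
Proof.
wlog x0 : x / 0 <= x.
  move=> h; have [/h//|/ltW x0] := leP 0 x.
  by have := h (- x); rewrite opprK sqrrN oppr_ge0 [expR _ + _]addrC; apply.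
set y := x / 2; have y0 : 0 <= y by rewrite divr_ge0.
have e1 : 1 + y <= expR y := expR_ge1Dx y.
have e2 : expR (- y) <= 1 by rewrite -expR0 ler_expR oppr_le0.
have e12 : expR y * expR (- y) = 1 by rewrite -expRD subrr expR0.
have -> : expR x = expR y ^+ 2 by rewrite expr2 -expRD -splitr.
have -> : expR (- x) = expR (- y) ^+ 2 by rewrite expr2 -expRD -opprD -splitr.
have -> : x = 2 * y by rewrite /y mulrC divfK.
nra.
Qed.

(** * Moments of step integrals and of their almost sure limits *)

Section ito_limits.
Context d (Omega : measurableType d) (R : realType) (P : probability Omega R).
Variables (T : R) (F : R -> set (set Omega)) (B : R -> Omega -> R).
Hypothesis hF : complete_filtration P T F.
Hypothesis hB : brownian_motion P T F B.
Notation mu := (@lebesgue_measure R).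
Local Notation N f := (\int[mu]_(x in `[0, T]) (f x ^+ 2)).
Implicit Type g : seq (R * R * R).

Lemma measurable_wrt_step_ito t g : 0 <= t <= T -> step_wf t g ->
  measurable_wrt (F t) (step_ito B g).
Proof.
move=> tT wg; have sF := filtration_sigma_algebra hF tT; have /andP[_ t1] := tT.
apply: measurable_wrt_sum => // -[[a s] u] /wg[s0 su ut].
apply: measurable_wrtZ => //.
have -> : (fun w => B u w - B s w) = (fun w => B u w + -1 * B s w).
  by apply/funext => w; rewrite mulN1r.
apply: measurable_wrtD => //; last apply: measurable_wrtZ => //;
  apply: (adapted_wrt hF (bm_adapted hB)) => //; lra.
Qed.

Lemma measurable_step_ito g : 0 <= T -> step_wf T g ->
  measurable_fun setT (step_ito B g).
Proof.
move=> T0 wg; have tT : 0 <= T <= T by rewrite T0 lexx.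
apply: measurable_wrt_fun (measurable_wrt_step_ito tT wg).
by case: hF => _ + _ _; apply.
Qed.

Hypothesis T0 : 0 <= T.

Let measurable_expR_comp (X : Omega -> R) : measurable_fun setT X ->
  measurable_fun setT (fun w => expR (X w)).
Proof. by move=> mX; apply: measurableT_comp. Qed.

Lemma integral_step_scale c g : N (step_fun (step_scale c g)) = c ^+ 2 * N (step_fun g).
Proof.
rewrite -RintegralZl//; last by have [] := step_fun_square_integrable T g.
by apply: eq_Rintegral => x _; rewrite step_fun_scale exprMn.
Qed.

(** The exponential moments of [g] and of its opposite are added and inserted into [sqr_le_expR].
    The bound is cruder than the isometry, but it vanishes with the squared norm of the step
    function, which is what L^2 convergence requires. *)
Lemma step_ito_sqr_le g : step_wf T g ->
  (\int[P]_w ((step_ito B g w) ^+ 2)%:E <=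
   (8 * (expR (2^-1 * N (step_fun g)) - 1))%:E)%E.
Proof.
move=> wg; have mS := measurable_step_ito T0 wg.
have wNg := step_wf_scale (c := -1) wg; have mNS := measurable_step_ito T0 wNg.
set V := N _; have VN : N (step_fun (step_scale (-1) g)) = V.
  by rewrite integral_step_scale sqrrN expr1n mul1r.
have E1 := step_ito_mgf hF hB wg; have E2 := step_ito_mgf hF hB wNg.
rewrite VN -/V in E1 E2.
suff : (\int[P]_w ((step_ito B g w ^+ 2)%:E + 8%:E) <= (8 * expR (2^-1 * V))%:E)%E.
  rewrite ge0_integralD//; last 2 first.
  - by move=> w _; rewrite lee_fin sqr_ge0.
  - by apply/measurable_EFinP; exact: measurable_funX.
  rewrite integral_probability_cst mulrBr mulr1 EFinB.
  by rewrite leeBrDr.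
have -> : (8 * expR (2^-1 * V))%:E =
    (\int[P]_w (4%:E * (expR (step_ito B g w))%:E + 4%:E * (expR (step_ito B (step_scale (-1) g) w))%:E))%E.
  have mexp (h : seq (R * R * R)) : measurable_fun setT (step_ito B h) ->
      measurable_fun setT (fun w => (expR (step_ito B h w))%:E).
    by move=> mh; apply/measurable_EFinP; exact: measurable_expR_comp.
  rewrite ge0_integralD//; first last.
  - by apply: measurable_funeM; exact: mexp.
  - by apply: measurable_funeM; exact: mexp.
  rewrite !ge0_integralZl//; try exact: mexp.
  rewrite E1 E2 -!EFinM -EFinD; congr (_%:E); ring.
apply: ge0_le_integral => //.
- by move=> w _; rewrite -EFinD lee_fin addr_ge0 ?sqr_ge0.
- by apply/measurable_EFinP; apply: measurable_funD => //; exact: measurable_funX.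
- apply/measurable_EFinP; apply: measurable_funD => //; apply: measurable_funM => //;
  exact: measurable_expR_comp.
move=> w _; rewrite -!EFinM -!EFinD lee_fin step_ito_scale mulN1r.
by have := sqr_le_expR (step_ito B g w); lra.
Qed.

Lemma cvg_expR_half (v_ : nat -> R) (v : R) : v_ n @[n --> \oo] --> v ->
  expR (2^-1 * v_ n) @[n --> \oo] --> expR (2^-1 * v).
Proof.
move=> vv; apply: (cvg_comp (fun n => 2^-1 * v_ n) expR); last exact: continuous_expR.
exact: cvgMr.
Qed.

Section mgf_limit.
Variables (g_ : nat -> seq (R * R * R)) (f : R -> R) (Z : Omega -> R).
Hypothesis wg : forall n, step_wf T (g_ n).
Hypothesis f2 : square_integrable mu `[0, T] f.
Hypothesis g_f : N (fun x => step_fun (g_ n) x - f x) @[n --> \oo] --> 0.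
Hypothesis mZ : measurable_fun setT Z.
Hypothesis SZ : {ae P, forall w, step_ito B (g_ n) w @[n --> \oo] --> Z w}.

Let mS n : measurable_fun setT (step_ito B (g_ n)).
Proof. exact: measurable_step_ito. Qed.
Let S2 n := step_fun_square_integrable T (g_ n).

Let combine n m := step_scale 2 (g_ n) ++ step_scale (-1) (g_ m).

Let cvg_square_combine n : N (step_fun (combine n m)) @[m --> \oo] -->
  N (fun x => 2 * step_fun (g_ n) x - f x).
Proof.
apply: cvg_integral_sqr => //.
- by move=> m; exact: step_fun_square_integrable.
- by apply: square_integrableB => //; exact: square_integrableZ.
apply: cvg_trans g_f; apply: near_eq_cvg; apply: nearW => m.
apply: eq_Rintegral => x _; rewrite step_fun_cat !step_fun_scale.
by rewrite -[LHS]sqrrN; congr (_ ^+ 2); ring.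
Qed.

Let cvg_square_limit : N (fun x => 2 * step_fun (g_ n) x - f x) @[n --> \oo] --> N f.
Proof.
apply: cvg_integral_sqr => //.
- by move=> n; apply: square_integrableB => //; exact: square_integrableZ.
have c4 : 4 * N (fun x => step_fun (g_ n) x - f x) @[n --> \oo] --> (4 * 0 : R).
  exact: cvgMr.
rewrite mulr0 in c4.
apply: cvg_trans c4; apply: near_eq_cvg; apply: nearW => m.
rewrite -RintegralZl//; last first.
  have [] : square_integrable mu `[0, T] (fun x => step_fun (g_ m) x - f x) => //.
  exact: square_integrableB.
by apply: eq_Rintegral => x _; ring.
Qed.

Lemma ito_mgf_limit : (\int[P]_w (expR (Z w))%:E = (expR (2^-1 * N f))%:E)%E.
Proof.
have mexp (X : Omega -> R) : measurable_fun setT X ->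
    measurable_fun setT (fun w => (expR (X w))%:E).
  by move=> mX; apply/measurable_EFinP; exact: measurable_expR_comp.
have up : (\int[P]_w (expR (Z w))%:E <= (expR (2^-1 * N f))%:E)%E.
  apply: (@fatou_le _ _ _ _ _ _ (fun n w => expR (step_ito B (g_ n) w)) _
    (fun n => expR (2^-1 * N (step_fun (g_ n))))) => //.
  - by move=> n; exact: measurable_expR_comp.
  - exact: measurable_expR_comp.
  - by move=> n; rewrite (step_ito_mgf hF hB).
  - by apply: filterS SZ => w h _; apply: cvg_comp h _; exact: continuous_expR.
  - by apply: cvg_expR_half; exact: cvg_integral_sqr.
(* The first application of Fatou's lemma makes the moment finite, so the reverse inequality can be
   stated between real numbers. *)
have [z zE] : exists z : R, (\int[P]_w (expR (Z w))%:E = z%:E)%E.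
  apply: EFin_fin_numP; rewrite ge0_fin_numE ?integral_ge0//.
  by apply: le_lt_trans up _; rewrite ltry.
rewrite zE in up *; apply/eqP; rewrite eq_le up/= lee_fin.
(* [2 e^S <= e^Z + e^(2S - Z)] *)
have low n : 2 * expR (2^-1 * N (step_fun (g_ n))) <=
    z + expR (2^-1 * N (fun x => 2 * step_fun (g_ n) x - f x)).
  (* Here [n] is fixed and only [m] tends to infinity, turning 2 S_n - S_m into 2 S_n - Z. *)
  have lim_n : (\int[P]_w (expR (2 * step_ito B (g_ n) w - Z w))%:E <=
      (expR (2^-1 * N (fun x => 2 * step_fun (g_ n) x - f x)))%:E)%E.
    have wc m : step_wf T (combine n m).
      by apply: step_wf_cat; exact: step_wf_scale.
    apply: (@fatou_le _ _ _ _ _ _ (fun m w => expR (step_ito B (combine n m) w)) _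
      (fun m => expR (2^-1 * N (step_fun (combine n m))))) => //.
    - by move=> m; apply: measurable_expR_comp; exact: measurable_step_ito.
    - apply: measurable_expR_comp; apply: measurable_funB => //.
      exact: measurable_funM.
    - by move=> m; rewrite (step_ito_mgf hF hB).
    - apply: filterS SZ => w h _.
      have hl : step_ito B (combine n m) w @[m --> \oo] -->
          (2 * step_ito B (g_ n) w - Z w : R).
        under eq_fun do rewrite step_ito_cat !step_ito_scale mulN1r.
        by apply: cvgB => //; exact: cvg_cst.
      by apply: cvg_comp hl _; exact: continuous_expR.
    - exact: cvg_expR_half.
  have m2 : measurable_fun setT (fun w => (expR (2 * step_ito B (g_ n) w - Z w))%:E).
    by apply: mexp; apply: measurable_funB => //; exact: measurable_funM.
  rewrite -lee_fin EFinD -zE EFinM -(step_ito_mgf hF hB (@wg n)).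
  rewrite -ge0_integralZl//; last exact: mexp.
  apply: le_trans (leeD2l _ lim_n); rewrite -ge0_integralD//; last exact: mexp.
  apply: ge0_le_integral => //.
  - by apply: measurable_funeM; exact: mexp.
  - by apply: emeasurable_funD => //; exact: mexp.
  move=> w _; rewrite -EFinM -EFinD lee_fin.
  rewrite expRD expRM_natl expRN; set a := expR (step_ito _ _ _); set b := expR (Z w).
  have a0 : 0 < a := expR_gt0 _; have b0 : 0 < b := expR_gt0 _.
  rewrite -subr_ge0 (_ : _ - _ = (a - b) ^+ 2 / b); last by field; rewrite gt_eqF.
  by rewrite divr_ge0 ?sqr_ge0// ltW.
(* As [n] grows, both exponents tend to N f / 2: twice the expected value is at most [z] plus the
   expected value. *)
suff : 2 * expR (2^-1 * N f) <= z + expR (2^-1 * N f) by lra.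
have c1 : 2 * expR (2^-1 * N (step_fun (g_ n))) @[n --> \oo] --> 2 * expR (2^-1 * N f).
  by apply: cvgMr; apply: cvg_expR_half; exact: cvg_integral_sqr.
have c2 : z + expR (2^-1 * N (fun x => 2 * step_fun (g_ n) x - f x)) @[n --> \oo] -->
    z + expR (2^-1 * N f).
  by apply: cvgD; [exact: cvg_cst|exact: cvg_expR_half].
apply: ler_cvg_to c1 c2 _; exact: nearW.
Qed.

End mgf_limit.

End ito_limits.

(** * The law of the terminal fund *)

Section partitions.
Context {R : realType}.
Notation mu := (@lebesgue_measure R).
Implicit Types (f h q X : R -> R) (s xi : nat -> R).

Lemma near_mesh_lt (T e : R) : 0 < e -> \forall n \near \oo, T / n.+1%:R < e.
Proof.
move=> e0; have h : T * harmonic n @[n --> \oo] --> (T * 0 : R).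
  by apply: cvgMr; exact: cvg_harmonic.
rewrite mulr0 in h; move/cvgr0_norm_lt : h => /(_ _ e0).
by apply: filterS => n; apply: le_lt_trans; rewrite ler_norm.
Qed.

(** Heine's theorem phrased with the mesh size. In the local step, half of the radius of continuity
    is spent on moving the centre and half on the mesh. *)
Lemma uniformly_continuous_itv T f e : {within `[0, T], continuous f} -> 0 < e ->
  \forall n \near \oo, forall x y : R, 0 <= x <= T -> 0 <= y <= T ->
    `|x - y| <= T / n.+1%:R -> `|f x - f y| <= e.
Proof.
move=> /subspace_continuousP cf e0.
have /compact_near_coveringP cpt := @segment_compact R 0 T.
pose good (n : nat) (x : R) := 0 <= x <= T -> forall y, 0 <= y <= T ->
    `|x - y| <= T / n.+1%:R -> `|f x - f y| <= e.
have : \forall n \near \oo, `[0, T] `<=` good n.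
  apply: cpt => x x0T.
  have e2 : 0 < e / 2 by rewrite divr_gt0.
  have /cvgrPdist_lt/(_ _ e2) := cf x x0T.
  rewrite near_withinE => /nbhs_ballP[dl /= dl0 hd].
  have dl2 : 0 < dl / 2 by rewrite divr_gt0.
  exists (ball x (dl / 2), [set n | T / n.+1%:R < dl / 2]); first split => /=.
  - exact: nbhsx_ballx.
  - exact: near_mesh_lt.
  move=> [x' n] [/= xx' nd] xT y yT x'y.
  have hx' : `|f x - f x'| < e / 2.
    apply: hd; last by rewrite /= in_itv.
    by apply: lt_trans xx' _; lra.
  have hy : `|f x - f y| < e / 2.
    apply: hd; last by rewrite /= in_itv.
    have xx2 : `|x - x'| < dl / 2 := xx'.
    have h : `|x - y| <= `|x - x'| + `|x' - y|.
      by rewrite (le_trans _ (ler_normD _ _))// addrA subrK.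
    have nd' : T / n.+1%:R < dl / 2 := nd.
    have hd' : `|x - x'| + `|x' - y| < dl by rewrite [dl]splitr ltrD// (le_lt_trans x'y).
    exact: le_lt_trans h hd'.
  have h : `|f x' - f y| <= `|f x - f y| + `|f x - f x'|.
    rewrite (_ : f x' - f y = (f x - f y) - (f x - f x')); last by ring.
    exact: ler_normB.
  by apply: le_trans h _; rewrite [e]splitr lerD// ltW.
apply: filterS => n hn x y xT yT.
by apply: hn => //=; rewrite in_itv.
Qed.

Lemma Rintegral_itv_split f a b c : a <= b -> b <= c ->
  mu.-integrable `[a, c] (EFin \o f) ->
  \int[mu]_(x in `[a, c]) f x = \int[mu]_(x in `[a, b]) f x + \int[mu]_(x in `[b, c]) f x.
Proof.
move=> ab bc fi; have := @Rintegral_itvB _ f (BLeft a) (BRight c) b fi.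
rewrite !bnd_simp => /(_ ab bc) /eqP; rewrite subr_eq addrC => /eqP ->.
rewrite Rintegral_itv_obnd_cbnd//; apply: integrableS fi => //.
by move=> x /=; rewrite !in_itv/=; lra.
Qed.

Lemma integrable_subitv f a b a' b' : a' <= a -> b <= b' ->
  mu.-integrable `[a', b'] (EFin \o f) -> mu.-integrable `[a, b] (EFin \o f).
Proof.
move=> aa bb; apply: integrableS => //.
by move=> x /=; rewrite !in_itv/=; lra.
Qed.

(** These are Riemann-Stieltjes sums of [q] against a primitive of [h]. The subdivision is an
    arbitrary sequence, so that the induction can drop its last interval; a uniform mesh would
    change with n. *)
Lemma tagged_sum_close s xi q h e n : (forall i, (i < n)%N -> s i <= s i.+1) ->
  mu.-integrable `[s 0%N, s n] (EFin \o h) ->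
  mu.-integrable `[s 0%N, s n] (EFin \o (fun u => q u * h u)) ->
  (forall i u, (i < n)%N -> s i <= u <= s i.+1 -> `|q (xi i) - q u| <= e) ->
  `|\sum_(i < n) q (xi i) * \int[mu]_(u in `[s i, s i.+1]) h u
    - \int[mu]_(u in `[s 0%N, s n]) (q u * h u)| <=
  e * \int[mu]_(u in `[s 0%N, s n]) `|h u|.
Proof.
elim: n => [|n IH] ss hi qhi qe.
  by rewrite big_ord0 set_itv1 !Rintegral_set1 subr0 normr0 mulr0.
have s0n : s 0%N <= s n.
  elim: n ss {IH hi qhi qe} => // n IH ss.
  by apply: le_trans (IH _) (ss n _) => // i ni; apply: ss; rewrite ltnS ltnW.
have snn := ss n (ltnSn n).
have h1 := integrable_subitv (lexx _) snn hi; have h2 := integrable_subitv s0n (lexx _) hi.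
have q1 := integrable_subitv (lexx _) snn qhi; have q2 := integrable_subitv s0n (lexx _) qhi.
have {}IH := IH (fun i ni => ss i (ltnW ni)) h1 q1 (fun i u ni => qe i u (ltnW ni)).
rewrite big_ord_recr/= (Rintegral_itv_split s0n snn qhi).
rewrite (@Rintegral_itv_split (fun u => `|h u|) _ _ _ s0n snn); last exact: integrable_norm.
rewrite mulrDr opprD addrACA; apply: le_trans (ler_normD _ _) (lerD IH _).
rewrite -RintegralZl// -RintegralB//; last exact: (integrableZl _ (q (xi n)) h2).
apply: le_trans (le_normr_Rintegral _ _) _ => //.
  exact: (integrableB _ (integrableZl _ (q (xi n)) h2) q2).
rewrite -RintegralZl//; last exact: integrable_norm.
apply: le_Rintegral => //.
- apply: integrable_norm; exact: (integrableB _ (integrableZl _ (q (xi n)) h2) q2).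
- apply: (integrableZl _ e (integrable_norm h2)) => //.
move=> u; rewrite /= in_itv/= => su; rewrite -mulrBl normrM ler_wpM2r//.
exact: qe.
Qed.

End partitions.

Section interval_integrals.
Context {R : realType}.
Notation mu := (@lebesgue_measure R).
Implicit Types (F f h q X : R -> R).

Lemma Rintegral_is_derive F f a b : a <= b ->
  (forall x : R, is_derive x (1 : R) F (f x)) -> continuous f ->
  \int[mu]_(x in `[a, b]) f x = F b - F a.
Proof.
rewrite le_eqVlt => /predU1P[<- _ _|ab dF cf].
  by rewrite set_itv1 Rintegral_set1 subrr.
have cF : continuous F.
  move=> x; apply: differentiable_continuous; apply/derivable1_diffP.
  by have [] := dF x.
rewrite /Rintegral (@continuous_FTC2 _ f F)//.
- exact: continuous_subspaceT.
- split; first by move=> x _; have [] := dF x.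
    by apply: cvg_at_right_filter; exact: cF.
  by apply: cvg_at_left_filter; exact: cF.
- by move=> x _; rewrite derive1E; exact: derive_val.
Qed.

Lemma integrable_within_continuous f a b : {within `[a, b], continuous f} ->
  mu.-integrable `[a, b] (EFin \o f).
Proof. by move=> cf; apply: continuous_compact_integrable => //; exact: segment_compact. Qed.

Lemma within_continuous_bounded q a b : {within `[a, b], continuous q} ->
  exists c, forall x, a <= x <= b -> `|q x| <= c.
Proof.
move=> cq; have [M [_ hM]] := compact_bounded (continuous_compact cq (@segment_compact R a b)).
exists (M + 1) => x axb; apply: hM; first by rewrite ltrDl.
by exists x.
Qed.

Lemma integrable_continuousM q h a b : {within `[a, b], continuous q} ->
  mu.-integrable `[a, b] (EFin \o h) ->
  mu.-integrable `[a, b] (EFin \o (fun x => q x * h x)).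
Proof.
move=> cq hi; have [c qc] := within_continuous_bounded cq.
have mh : measurable_fun `[a, b] h by apply/measurable_EFinP; exact: measurable_int hi.
have mD : measurable (`[a, b]%classic : set (measurableTypeR R)) by exact: measurable_itv.
apply: (integrable_dominated (mu := mu) (g := fun x => c * `|h x|) mD).
- by apply: measurable_funM => //; exact: subspace_continuous_measurable_fun.
- exact: (integrableZl _ c (integrable_norm hi)).
- by move=> x; rewrite /= in_itv/= => xab; rewrite normrM ler_wpM2r ?qc.
Qed.

(** There are n + 1 subintervals, so the right end has index n + 1 and n = 0 causes no division by
    zero. *)
Definition mesh (T : R) (n i : nat) : R := i%:R * (T / n.+1%:R).

Lemma mesh0 T n : mesh T n 0 = 0. Proof. by rewrite /mesh mul0r. Qed.

Lemma meshn T n : mesh T n n.+1 = T.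
Proof. by rewrite /mesh mulrC divfK// pnatr_eq0. Qed.

Lemma mesh_succ T n i : mesh T n i.+1 = mesh T n i + T / n.+1%:R.
Proof. by rewrite /mesh -natr1 mulrDl mul1r. Qed.

Lemma mesh_leS T n i : 0 <= T -> mesh T n i <= mesh T n i.+1.
Proof. by move=> T0; rewrite mesh_succ lerDl divr_ge0. Qed.

Lemma mesh_bound T n i : 0 <= T -> (i <= n.+1)%N -> 0 <= mesh T n i <= T.
Proof.
move=> T0 ni; rewrite mulr_ge0 ?divr_ge0//= -[leRHS](meshn T n).
by rewrite ler_wpM2r ?divr_ge0// ler_nat.
Qed.

Lemma cvg_tagged_sum T q h (xi : nat -> nat -> R) : 0 <= T ->
  {within `[0, T], continuous q} -> mu.-integrable `[0, T] (EFin \o h) ->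
  (forall n i, mesh T n i <= xi n i <= mesh T n i.+1) ->
  \sum_(i < n.+1) q (xi n i) * \int[mu]_(u in `[mesh T n i, mesh T n i.+1]) h u
    @[n --> \oo] --> \int[mu]_(u in `[0, T]) (q u * h u).
Proof.
move=> T0 cq hi xis; have qhi := integrable_continuousM cq hi.
apply/cvgrPdist_le => e e0; set H := \int[mu]_(u in `[0, T]) `|h u|.
have H0 : 0 <= H by apply: Rintegral_ge0.
have e1 : 0 < e / (H + 1) by rewrite divr_gt0// ltr_wpDl.
apply: filterS (uniformly_continuous_itv cq e1) => n hn.
have := @tagged_sum_close R (mesh T n) (xi n) q h (e / (H + 1)) n.+1.
rewrite mesh0 meshn => /(_ _ hi qhi) hsum; rewrite distrC.
apply: le_trans (hsum _ _) _.
- by move=> i _; exact: mesh_leS.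
- move=> i u ni /andP[su us]; have /andP[s1 s2] := xis n i.
  have /andP[b1 _] := mesh_bound T0 (ltnW ni); have /andP[_ b2] := mesh_bound T0 ni.
  have := mesh_succ T n i; move: (T / n.+1%:R) (hn (xi n i) u) => dl {}hn ms.
  apply: hn; [by apply/andP; split; lra|by apply/andP; split; lra|].
  by rewrite ler_norml; apply/andP; split; lra.
- rewrite -/H -mulrA ger_pMr// mulrC ler_pdivrMr ?ltr_wpDl// mul1r.
  by rewrite lerDl.
Qed.

Lemma is_derive_expR_lin (r T x : R) :
  is_derive x (1 : R) (fun u => expR (r * (T - u))) (- r * expR (r * (T - x))).
Proof.
have h : is_derive x (1 : R) (fun u => r * (T - u)) (- r).
  have h0 : is_derive x (1 : R) (r \*: (cst T - id)) (r *: (0 - 1)).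
    by apply: is_deriveZ; apply: is_deriveB.
  by apply: is_derive_eq h0 _; rewrite sub0r scalerN scaler1.
apply: is_derive_eq (is_derive1_comp (is_derive_expR _) h) _.
by rewrite mulrC.
Qed.

Lemma continuous_expR_lin (r T : R) : continuous (fun u => expR (r * (T - u))).
Proof.
move=> x; apply: differentiable_continuous; apply/derivable1_diffP.
by have [] := is_derive_expR_lin r T x.
Qed.

Lemma Rintegral_expR_lin (r T a b : R) : a <= b ->
  \int[mu]_(u in `[a, b]) (r * expR (r * (T - u))) = expR (r * (T - a)) - expR (r * (T - b)).
Proof.
move=> ab.
have dphi (x : R) : is_derive x (1 : R) (fun u => - expR (r * (T - u))) (r * expR (r * (T - x))).
  by apply: is_derive_eq (is_deriveN (is_derive_expR_lin r T x)) _; rewrite mulNr opprK.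
rewrite (Rintegral_is_derive ab dphi) 1?opprK 1?addrC//.
by move=> x; apply: cvgMr; exact: continuous_expR_lin.
Qed.

(* Both Riemann-Stieltjes sums obtained by summation by parts converge to the
   integral of r e^(r(T - u)) X, so they cancel in the limit. *)
Lemma cvg_discounted_increments (r T : R) X : 0 <= T ->
  {within `[0, T], continuous X} ->
  \sum_(i < n.+1) expR (r * (T - mesh T n i)) * (X (mesh T n i.+1) - X (mesh T n i)
     - r * \int[mu]_(u in `[mesh T n i, mesh T n i.+1]) X u)
    @[n --> \oo] --> X T - expR (r * T) * X 0.
Proof.
move=> T0 cX; pose phi u := expR (r * (T - u)).
have cphi : {within `[0, T], continuous phi}.
  by apply: continuous_subspaceT; exact: continuous_expR_lin.
have iX := integrable_within_continuous cX.
have irX : mu.-integrable `[0, T] (EFin \o (fun u => r * X u)).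
  exact: (integrableZl _ r iX).
have irphi : mu.-integrable `[0, T] (EFin \o (fun u => r * phi u)).
  exact: (integrableZl _ r (integrable_within_continuous cphi)).
(* Summation by parts leaves X at right endpoints against the increments of the discount factor,
   whereas the drift term carries the discount factor at left endpoints: hence the two choices of
   tags. *)
have c1 := cvg_tagged_sum (xi := fun n i => mesh T n i.+1) T0 cX irphi
  (fun n i => introT andP (conj (mesh_leS n i T0) (lexx _))).
have c2 := cvg_tagged_sum (xi := mesh T) T0 cphi irX
  (fun n i => introT andP (conj (lexx _) (mesh_leS n i T0))).
have eqI : \int[mu]_(u in `[0, T]) (phi u * (r * X u)) = \int[mu]_(u in `[0, T]) (X u * (r * phi u)).
  by apply: eq_Rintegral => u _; ring.
rewrite eqI in c2; set L : R := X T - expR (r * T) * X 0.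
have : L + (\sum_(i < n.+1) X (mesh T n i.+1) * \int[mu]_(u in `[mesh T n i, mesh T n i.+1]) (r * phi u)
    - \sum_(i < n.+1) phi (mesh T n i) * \int[mu]_(u in `[mesh T n i, mesh T n i.+1]) (r * X u))
    @[n --> \oo] --> L.
  rewrite -[X in _ --> X]addr0 -[X in L + X](subrr (\int[mu]_(u in `[0, T]) (X u * (r * phi u)))).
  by apply: cvgD; [exact: cvg_cst|exact: cvgB].
apply: cvg_trans; apply: near_eq_cvg; apply: nearW => n /=.
rewrite -sumrB.
have -> : L = \sum_(i < n.+1)
    (phi (mesh T n i.+1) * X (mesh T n i.+1) - phi (mesh T n i) * X (mesh T n i)).
  rewrite -(big_mkord xpredT (fun i => phi (mesh T n i.+1) * X (mesh T n i.+1)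
    - phi (mesh T n i) * X (mesh T n i))).
  by rewrite telescope_sumr// meshn mesh0 /phi subrr mulr0 expR0 mul1r subr0.
rewrite -big_split/=; apply: eq_bigr => i _.
rewrite Rintegral_expR_lin ?mesh_leS// -/(phi _) -/(phi (mesh T n i.+1)).
rewrite RintegralZl//; last first.
  apply: integrable_subitv iX; have /andP[] := mesh_bound T0 (ltnW (ltn_ord i)) => //.
  by have /andP[] := mesh_bound T0 (ltn_ord i).
ring.
Qed.

End interval_integrals.

(** * Step approximation of finite combinations of Ito integrals *)

Section ito_combination.
Context d (Omega : measurableType d) (R : realType) (P : probability Omega R).
Variables (T : R) (F : R -> set (set Omega)) (B : R -> Omega -> R).
Hypothesis hF : complete_filtration P T F.
Hypothesis hB : brownian_motion P T F B.
Notation mu := (@lebesgue_measure R).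

Lemma measurable_sum_mem (I : eqType) (s : seq I) (X : I -> Omega -> R) :
  (forall i, i \in s -> measurable_fun setT (X i)) ->
  measurable_fun setT (fun w => \sum_(i <- s) X i w).
Proof.
elim: s => [_|i s IH mX].
  by under eq_fun do rewrite big_nil; exact: measurable_cst.
under eq_fun do rewrite big_cons.
apply: measurable_funD; first by apply: mX; rewrite mem_head.
by apply: IH => j js; apply: mX; rewrite inE js orbT.
Qed.

Lemma near_cvge0 (u : nat -> \bar R) (e : R) : u n @[n --> \oo] --> 0%E -> 0 < e ->
  \forall n \near \oo, (u n <= e%:E)%E.
Proof.
move=> /fine_cvgP[ufin /cvgr0_norm_lt u0] e0.
near=> n.
have fu : u n \is a fin_num by near: n.
rewrite -(fineK fu) lee_fin; apply: le_trans (ler_norm _) _; apply: ltW.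
by near: n; exact: u0.
Unshelve. all: by end_near. Qed.

Lemma step_fun_eq0 t (g : seq (R * R * R)) x : step_wf t g -> t < x -> step_fun g x = 0.
Proof.
move=> wg tx; rewrite /step_fun big_seq big1// => -[[a s] u] /wg[s0 su ut].
rewrite indicE memNset ?mulr0//= in_itv/= => /andP[_ xu].
by move: (le_trans xu ut); rewrite leNgt tx.
Qed.

(** Truncating the integrand at t moves the approximation from [0, t] to [0, T], because a step
    function well formed for t vanishes beyond t. Integrals up to different times can then be
    combined on one interval. *)
Lemma ito_approx t (f : R -> R) (Y : Omega -> R) e : 0 <= t <= T ->
  ito_integral P B t f Y -> 0 < e ->
  exists g, [/\ step_wf t g,
    (\int[P]_w ((Y w - step_ito B g w) ^+ 2)%:E <= e%:E)%E &
    \int[mu]_(x in `[0, T]) ((step_fun g x - f x * \1_`[0, t] x) ^+ 2) <= e].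
Proof.
move=> /andP[t0 tT] [mY [g [wg gf gY]]] e0.
have [n [h1 h2]] : exists n,
   (\int[mu]_(x in `[0%R, t]) ((step_fun (g n) x - f x) ^+ 2)%:E <= e%:E)%E /\
   ('E_P[(fun w => (Y w - step_ito B (g n) w) ^+ 2)%R] <= e%:E)%E.
  have [n hn] := filter_ex (filterI (near_cvge0 gf e0) (near_cvge0 gY e0)).
  by exists n.
exists (g n); split => //; first by rewrite unlock in h2.
have -> : \int[mu]_(x in `[0, T]) ((step_fun (g n) x - f x * \1_`[0, t] x) ^+ 2) =
    \int[mu]_(x in `[0, t]) ((step_fun (g n) x - f x) ^+ 2).
  have {2}-> : `[0, t]%classic = `[0, T]%classic `&` `[0, t]%classic.
    by apply/esym/setIidr => x /=; rewrite !in_itv/=; lra.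
  rewrite Rintegral_mkcondr; apply: eq_Rintegral => x /set_mem/=.
  rewrite in_itv/= => /andP[x0 xT].
  rewrite patchE indicE; case: ifPn => xt; rewrite ?mulr1// mulr0 subr0.
  rewrite (step_fun_eq0 (wg n)) ?expr0n//.
  by move: xt; rewrite notin_setE/= in_itv/= x0/= => /negP; rewrite -ltNge.
have v0 : (0 <= \int[mu]_(x in `[0%R, t]) ((step_fun (g n) x - f x) ^+ 2)%:E)%E.
  by apply: integral_ge0 => x _; rewrite lee_fin sqr_ge0.
rewrite /Rintegral -lee_fin fineK// ge0_fin_numE//.
by apply: le_lt_trans h1 _; rewrite ltry.
Qed.

Lemma expectation_sqrD_le (c : R) (D E : Omega -> R) (e e' : R) :
  measurable_fun setT D -> measurable_fun setT E ->
  (\int[P]_w ((D w) ^+ 2)%:E <= e%:E)%E -> (\int[P]_w ((E w) ^+ 2)%:E <= e'%:E)%E ->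
  (\int[P]_w ((c * D w + E w) ^+ 2)%:E <= (2 * c ^+ 2 * e + 2 * e')%:E)%E.
Proof.
move=> mD mE hD hE.
have mX (X : Omega -> R) : measurable_fun setT X -> measurable_fun setT (fun w => (X w ^+ 2)%:E).
  by move=> mX; apply/measurable_EFinP; exact: measurable_funX.
have c0 : 0 <= 2 * c ^+ 2 by rewrite mulr_ge0 ?sqr_ge0.
apply: (@le_trans _ _ (\int[P]_w ((2 * c ^+ 2)%:E * (D w ^+ 2)%:E + 2%:E * (E w ^+ 2)%:E))%E).
  apply: ge0_le_integral => //.
  - by move=> w _; rewrite lee_fin sqr_ge0.
  - by apply: mX; apply: measurable_funD => //; exact: measurable_funM.
  - by apply: emeasurable_funD; apply: measurable_funeM; exact: mX.
  - move=> w _; rewrite -!EFinM -EFinD lee_fin.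
    by have := sqr_ge0 (c * D w - E w); lra.
rewrite ge0_integralD//; last 4 first.
- by move=> w _; rewrite -EFinM lee_fin mulr_ge0 ?sqr_ge0.
- by apply: measurable_funeM; exact: mX.
- by move=> w _; rewrite -EFinM lee_fin mulr_ge0 ?sqr_ge0.
- by apply: measurable_funeM; exact: mX.
rewrite !ge0_integralZl//; try exact: mX; try by move=> w _; rewrite lee_fin sqr_ge0.
apply: (@le_trans _ _ ((2 * c ^+ 2)%:E * e%:E + 2%:E * e'%:E)%E).
  by apply: leeD; apply: lee_wpmul2l; rewrite ?lee_fin.
by rewrite -!EFinM -EFinD.
Qed.

(** One step list is close to the combination of the [M t] in L^2(P) and, at the same time, to the
    corresponding combination of truncated integrands in L^2([0, T]); this ties the law of the
    combination to its integrand. *)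
Lemma ito_combination_approx (M : R -> Omega -> R) (f : R -> R) (L : seq (R * R)) e :
  0 <= T -> square_integrable mu `[0, T] f ->
  (forall t, 0 <= t <= T -> ito_integral P B t f (M t)) ->
  (forall p, p \in L -> 0 <= p.2 <= T) -> 0 < e ->
  exists g, [/\ step_wf T g,
    (\int[P]_w ((\sum_(p <- L) p.1 * M p.2 w - step_ito B g w) ^+ 2)%:E <= e%:E)%E &
    \int[mu]_(x in `[0, T])
       ((step_fun g x - \sum_(p <- L) p.1 * (f x * \1_`[0, p.2] x)) ^+ 2) <= e].
Proof.
move=> T0 f2 itoM; elim: L e => [|[c t] L IH] e LT e0.
  exists [::]; split => //.
    rewrite integral0_eq ?lee_fin ?ltW// => w _.
    by rewrite /step_ito !big_nil subr0 expr0n.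
  rewrite (@eq_Rintegral _ _ _ _ _ (fun=> 0)) ?Rintegral_cst ?mul0r ?ltW//.
  by move=> x _; rewrite /step_fun !big_nil subr0 expr0n.
have tT : 0 <= t <= T by have /= := LT _ (mem_head _ _).
have /andP[t0 tT1] := tT.
have e4 : 0 < e / 4 by rewrite divr_gt0.
(* The tolerances make each of the two terms of 2 c^2 (first error) + 2 (second error) at most e /
   2; the added 1 covers c = 0. *)
have dl0 : 0 < e / (4 * (c ^+ 2 + 1)) by rewrite divr_gt0// mulr_gt0// ltr_wpDl ?sqr_ge0.
have [g' [wg' Pg' mug']] := IH (e / 4) (fun p pL => LT p (mem_behead (s := (c, t) :: L) pL)) e4.
have [g [wg Pg mug]] := ito_approx tT (itoM _ tT) dl0.
have wgT := step_wf_le tT1 wg.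
have ee : 2 * c ^+ 2 * (e / (4 * (c ^+ 2 + 1))) + 2 * (e / 4) <= e.
  rewrite (_ : 2 * c ^+ 2 * _ = (c ^+ 2 / (c ^+ 2 + 1)) * (e / 2)); last first.
    by field; rewrite gt_eqF// ltr_wpDl ?sqr_ge0.
  have : c ^+ 2 / (c ^+ 2 + 1) <= 1 by rewrite ler_pdivrMr ?ltr_wpDl ?sqr_ge0// mul1r lerDl.
  have e2 : 0 <= e / 2 by rewrite divr_ge0// ltW.
  by move=> h; have := ler_wpM2r e2 h; lra.
have mM (s : R) : 0 <= s <= T -> measurable_fun setT (M s) by move=> /itoM[].
have mL : measurable_fun setT (fun w => \sum_(p <- L) p.1 * M p.2 w - step_ito B g' w).
  apply: measurable_funB; last exact: (measurable_step_ito hF hB).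
  apply: measurable_sum_mem => p pL; apply: measurable_funM => //.
  by apply: mM; apply: LT; rewrite inE pL orbT.
have mD : measurable_fun setT (fun w => M t w - step_ito B g w).
  by apply: measurable_funB; [exact: mM|exact: (measurable_step_ito hF hB)].
exists (step_scale c g ++ g'); split.
- by apply: step_wf_cat => //; exact: step_wf_scale.
- have /le_trans := expectation_sqrD_le c mD mL Pg Pg'; move=> /(_ e%:E); rewrite lee_fin => /(_ ee).
  apply: le_trans; rewrite le_eqVlt; apply/orP; left; apply/eqP.
  apply: eq_integral => w _; congr (_ ^+ 2)%:E.
  by rewrite big_cons/= step_ito_cat step_ito_scale; ring.
- have mD0 : measurable (`[0, T]%classic : set (measurableTypeR R)) by exact: measurable_itv.
  have D2 : square_integrable mu `[0, T] (fun x => step_fun g x - f x * \1_`[0, t] x).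
    by apply: square_integrableB => //;
      [exact: step_fun_square_integrable|exact: square_integrable_indic].
  have E2 : square_integrable mu `[0, T]
      (fun x => step_fun g' x - \sum_(p <- L) p.1 * (f x * \1_`[0, p.2] x)).
    apply: square_integrableB => //; first exact: step_fun_square_integrable.
    apply: square_integrable_sum => // p _; apply: square_integrableZ => //.
    exact: square_integrable_indic.
  apply: le_trans ee.
  have h := integral_sqrD_le mD0 c D2 E2.
  apply: (@le_trans _ _ (2 * c ^+ 2 * \int[mu]_(x in `[0, T]) ((step_fun g x - f x * \1_`[0, t] x) ^+ 2) +
    2 * \int[mu]_(x in `[0, T])
    ((step_fun g' x - \sum_(p <- L) p.1 * (f x * \1_`[0, p.2] x)) ^+ 2))); last first.
    have c20 : 0 <= 2 * c ^+ 2 by rewrite mulr_ge0 ?sqr_ge0.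
    by rewrite lerD ?ler_wpM2l.
  apply: le_trans h; rewrite le_eqVlt; apply/orP; left; apply/eqP.
  apply: eq_Rintegral => x _; congr (_ ^+ 2).
  by rewrite big_cons/= step_fun_cat step_fun_scale; ring.
Qed.

End ito_combination.

Section mesh_indicators.
Context {R : realType}.
Implicit Types (phi : R -> R) (T x e : R).

Definition mesh_indic T n i x : R := \1_`[0, mesh T n i] x.

(** The sum telescopes. On [0, T] its terms are the indicators of the point 0 and of the half-open
    mesh intervals, a partition of unity. *)
Lemma mesh_indic_sum T n x : 0 <= x <= T ->
  mesh_indic T n 0 x + \sum_(i < n.+1) (mesh_indic T n i.+1 x - mesh_indic T n i x) = 1.
Proof.
move=> xT; rewrite -(big_mkord xpredT (fun i => mesh_indic T n i.+1 x - mesh_indic T n i x)).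
rewrite telescope_sumr// addrC subrK /mesh_indic meshn indicE mem_set//.
Qed.

(** The weights are nonnegative with sum 1, so the difference is an average of the
    [phi (mesh T n i) - phi x], and only mesh points within one step of x have a nonzero weight. *)
Lemma mesh_indic_close T n phi e x : 0 <= T -> 0 <= x <= T ->
  (forall u u', 0 <= u <= T -> 0 <= u' <= T -> `|u - u'| <= T / n.+1%:R ->
    `|phi u - phi u'| <= e) ->
  `|phi 0 * mesh_indic T n 0 x
    + \sum_(i < n.+1) phi (mesh T n i) * (mesh_indic T n i.+1 x - mesh_indic T n i x)
    - phi x| <= e.
Proof.
move=> T0 xT hphi; have [x0 xT1] := andP xT.
have meshS i := mesh_leS n i T0.
have dlt0 : 0 <= T / n.+1%:R by rewrite divr_ge0.
have inc i : 0 <= mesh_indic T n i.+1 x - mesh_indic T n i x.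
  rewrite /mesh_indic !indicE !mem_setE !in_itv/= x0/= subr_ge0 ler_nat.
  by case: (leP x (mesh T n i)) => // /le_trans -> //.
have incE i : mesh_indic T n i.+1 x - mesh_indic T n i x != 0 ->
    mesh T n i <= x <= mesh T n i.+1.
  rewrite /mesh_indic !indicE !mem_setE !in_itv/= x0/=.
  case: (leP x (mesh T n i)) => [xi|/ltW ->].
    by rewrite (le_trans xi (meshS i)) subrr eqxx.
  by case: (leP x (mesh T n i.+1)) => //; rewrite subrr eqxx.
rewrite -[X in _ - X]mulr1 -(mesh_indic_sum n xT) mulrDr opprD addrACA -mulrBl.
rewrite mulr_sumr -sumrB -[e]mulr1 -(mesh_indic_sum n xT) mulrDr mulr_sumr.
apply: le_trans (ler_normD _ _) (lerD _ _).
  rewrite /mesh_indic mesh0 indicE normrM normr_nat.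
  case: (boolP (x \in _)); rewrite ?mulr0// !mulr1 => /set_mem/=.
  rewrite in_itv/= x0/= => xle0; apply: hphi => //; first by rewrite lexx.
  by rewrite (_ : x = 0) ?subrr ?normr0//; lra.
apply: le_trans (ler_norm_sum _ _ _) _; apply: ler_sum => i _.
rewrite -mulrBl normrM (ger0_norm (inc i)).
have [->|/incE/andP[ix xi]] := eqVneq (mesh_indic T n i.+1 x - mesh_indic T n i x) 0.
  by rewrite !mulr0.
apply: ler_wpM2r => //; apply: hphi => //; first exact/mesh_bound/ltnW.
have := mesh_succ T n i; move: (T / n.+1%:R) dlt0 => dl dl0 ms.
by rewrite ler_norml; apply/andP; split; lra.
Qed.

End mesh_indicators.

Section fund_law.
Context {R : realType} (m : model R).
Context d (Omega : measurableType d) (P : probability Omega R).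
Variables (F : R -> set (set Omega)) (B : R -> Omega -> R).
Local Notation T := (horizon m).
Notation mu := (@lebesgue_measure R).
Local Notation N f := (\int[mu]_(x in `[0, T]) (f x ^+ 2)).
Hypothesis hF : complete_filtration P T F.
Hypothesis hB : brownian_motion P T F B.
Hypothesis T0 : 0 <= T.

(** Variation of constants gives X_T = x_1 e^(rT) + \int e^(r(T - t)) (v I - C) dt + sigma \int
    e^(r(T - t)) I dB; [fund_mean] and [fund_var] are the mean and the variance of this Gaussian
    variable. *)
Definition fund_mean (I C : R -> R) : R := fund0 m * expR (rate m * T) +
  \int[mu]_(t in `[0, T]) (expR (rate m * (T - t)) * (excess m * I t - C t)).

Definition fund_var (I : R -> R) : R := volatility m ^+ 2 *
  \int[mu]_(t in `[0, T]) (expR (2 * rate m * (T - t)) * I t ^+ 2).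

Lemma admissible_square_integrable I C : admissible m I C ->
  square_integrable mu `[0, T] I.
Proof. by case=> mI I2 _ _; split. Qed.

Let mT : measurable (`[0, T]%classic : set (measurableTypeR R)).
Proof. exact: measurable_itv. Qed.

Lemma square_integrable_integrable I : square_integrable mu `[0, T] I ->
  mu.-integrable `[0, T] (EFin \o I).
Proof.
move=> I2; have one2 : square_integrable mu `[0, T] (cst 1).
  by apply: square_integrable_continuous; apply: continuous_subspaceT; exact: cst_continuous.
by apply: eq_integrable (integrable_mul mT one2 I2) => // x _ /=; rewrite mul1r.
Qed.

Lemma admissible_drift_integrable I C : admissible m I C ->
  mu.-integrable `[0, T] (EFin \o (fun t => excess m * I t - C t)).
Proof.
move=> aIC; have I1 := square_integrable_integrable (admissible_square_integrable aIC).
case: aIC => _ _ iC _.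
by have := integrableB mT (integrableZl mT (excess m) I1) iC; apply: eq_integrable.
Qed.

Section path.
Variables (I C X : R -> R) (M : R -> R).
Hypothesis aIC : admissible m I C.
Hypothesis cX : {within `[0, T], continuous X}.
Hypothesis sde : forall t, 0 <= t <= T ->
  X t = fund0 m + \int[mu]_(s in `[0, t]) (rate m * X s + excess m * I s - C s) + M t.

Let a t := excess m * I t - C t.
Let ia : mu.-integrable `[0, T] (EFin \o a) := admissible_drift_integrable aIC.
Let iX := integrable_within_continuous cX.

Let irXa : mu.-integrable `[0, T] (EFin \o (fun s => rate m * X s + excess m * I s - C s)).
Proof.
have := integrableD mT (integrableZl mT (rate m) iX) ia.
by apply: eq_integrable => // s _ /=; rewrite -!EFinM -EFinD /a addrA.
Qed.

Let increment s t : 0 <= s -> s <= t -> t <= T ->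
  M t - M s = X t - X s - rate m * \int[mu]_(u in `[s, t]) X u - \int[mu]_(u in `[s, t]) a u.
Proof.
move=> s0 st tT; have sT := le_trans st tT; have t0 := le_trans s0 st.
have iXst := integrable_subitv s0 tT iX; have iast := integrable_subitv s0 tT ia.
have mst : measurable (`[s, t]%classic : set (measurableTypeR R)) by exact: measurable_itv.
rewrite (sde (introT andP (conj t0 tT))) (sde (introT andP (conj s0 sT))).
rewrite (Rintegral_itv_split s0 st (integrable_subitv (lexx 0) tT irXa)).
have -> : \int[mu]_(x in `[s, t]) (rate m * X x + excess m * I x - C x) =
    rate m * \int[mu]_(u in `[s, t]) X u + \int[mu]_(u in `[s, t]) a u.
  rewrite -RintegralZl// -RintegralD//; last exact: (integrableZl _ (rate m) iXst).
  by apply: eq_Rintegral => x _; rewrite /a addrA.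
ring.
Qed.

(** A statement about a single path: the equation expresses the increments of M by those of X and by
    time integrals, to which the deterministic limits of tagged sums apply. The term in [M 0] is
    carried along because the equation at time 0 only gives X 0 = x_1 + M 0. *)
Lemma cvg_discounted_noise :
  expR (rate m * T) * M 0 + \sum_(i < n.+1) expR (rate m * (T - mesh T n i)) *
     (M (mesh T n i.+1) - M (mesh T n i)) @[n --> \oo] --> X T - fund_mean I C.
Proof.
pose r := rate m; pose phi u := expR (r * (T - u)).
have cphi : {within `[0, T], continuous phi}.
  by apply: continuous_subspaceT; exact: continuous_expR_lin.
have c1 := cvg_discounted_increments (r := r) T0 cX.
have c2 := cvg_tagged_sum (xi := mesh T) T0 cphi ia
  (fun n i => introT andP (conj (lexx _) (mesh_leS n i T0))).
have X0 : X 0 = fund0 m + M 0.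
  by rewrite (sde (introT andP (conj (lexx 0) T0))) set_itv1 Rintegral_set1 addr0.
have eqL : X T - fund_mean I C = expR (r * T) * (X 0 - fund0 m) +
    ((X T - expR (r * T) * X 0) - \int[mu]_(u in `[0, T]) (phi u * a u)).
  by rewrite /fund_mean -/r -/phi /a; ring.
rewrite eqL.
have : expR (r * T) * (X 0 - fund0 m) +
   (\sum_(i < n.+1) expR (r * (T - mesh T n i)) * (X (mesh T n i.+1) - X (mesh T n i)
     - r * \int[mu]_(u in `[mesh T n i, mesh T n i.+1]) X u)
    - \sum_(i < n.+1) phi (mesh T n i) * \int[mu]_(u in `[mesh T n i, mesh T n i.+1]) a u)
   @[n --> \oo] --> expR (r * T) * (X 0 - fund0 m) +
    ((X T - expR (r * T) * X 0) - \int[mu]_(u in `[0, T]) (phi u * a u)).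
  by apply: cvgD; [exact: cvg_cst|exact: cvgB].
apply: cvg_trans; apply: near_eq_cvg; apply: nearW => n /=.
rewrite X0 [_ + _ - fund0 m]addrAC subrr add0r; congr (_ + _).
rewrite -sumrB; apply: eq_bigr => i _.
have /andP[m0 _] := mesh_bound T0 (ltnW (ltn_ord i)).
have /andP[_ mT'] := mesh_bound T0 (ltn_ord i).
rewrite (increment m0 (mesh_leS n i T0) mT') -/r /phi; ring.
Qed.

End path.

Lemma fund_mgf (I C : R -> R) (X : R -> Omega -> R) (c : R) :
  admissible m I C -> fund_process m P F B I C X ->
  (\int[P]_w (expR (c * X T w))%:E =
   (expR (c * fund_mean I C + 2^-1 * (c ^+ 2 * fund_var I)))%:E)%E.
Proof.
move=> aIC [aX cX [M itoM sde]].
pose r := rate m; pose phi u := c * expR (r * (T - u)).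
pose f s := volatility m * I s.
have I2 := admissible_square_integrable aIC.
have f2 : square_integrable mu `[0, T] f by exact: square_integrableZ.
have cphi : {within `[0, T], continuous phi}.
  by apply: continuous_subspaceT => x; apply: cvgMr; exact: continuous_expR_lin.
(* The discounted noise as a list of coefficients and times: the first pair carries [M 0], and each
   mesh interval contributes its two endpoints. The factor [c] is absorbed into [phi], so only the
   exponential moment of order 1 is taken in the limit. *)
pose L n : seq (R * R) := (phi 0, mesh T n 0) ::
  flatten [seq [:: (phi (mesh T n i), mesh T n i.+1); (- phi (mesh T n i), mesh T n i)]
          | i : 'I_n.+1 <- enum 'I_n.+1].
have sumL n (G : R -> R) : \sum_(p <- L n) p.1 * G p.2 = phi 0 * G (mesh T n 0) +
    \sum_(i < n.+1) phi (mesh T n i) * (G (mesh T n i.+1) - G (mesh T n i)).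
  rewrite big_cons/=; congr (_ + _); rewrite big_flatten/= big_map big_enum/=.
  by apply: eq_bigr => i _; rewrite big_cons big_seq1/=; ring.
have LT n p : p \in L n -> 0 <= p.2 <= T.
  rewrite inE => /predU1P[->/=|]; first exact: mesh_bound.
  move=> /flattenP[_ /mapP[i _ ->]]; rewrite !inE => /orP[]/eqP ->/=.
    exact: mesh_bound.
  by apply: mesh_bound => //; exact: ltnW.
have /choice[g hg] : forall n, exists g, [/\ step_wf T g,
    (\int[P]_w ((\sum_(p <- L n) p.1 * M p.2 w - step_ito B g w) ^+ 2)%:E <= (2^-1 ^+ n.+1)%:E)%E &
    \int[mu]_(x in `[0, T])
       ((step_fun g x - \sum_(p <- L n) p.1 * (f x * \1_`[0, p.2] x)) ^+ 2) <= 2^-1 ^+ n.+1].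
  by move=> n; apply: (ito_combination_approx hF hB) => //; exact: LT.
have phif2 : square_integrable mu `[0, T] (fun x => phi x * f x).
  have [K phiK] := within_continuous_bounded cphi.
  apply: (square_integrableM mT (g := phi) (c := K) _ _ f2).
    exact: subspace_continuous_measurable_fun.
  by move=> x; rewrite /= in_itv/=; exact: phiK.
have half0 : (2^-1 ^+ n.+1 : R) @[n --> \oo] --> (0 : R).
  rewrite (cvg_shiftS (fun n => 2^-1 ^+ n : R)); apply: cvg_expr.
  by rewrite ger0_norm ?invr_ge0// invf_lt1// ltr1n.
(* The integrand of the n-th combination is [f] times a step interpolation of [phi]; by uniform
   continuity its distance to [phi * f] is at most a small multiple of |f|. *)
have g_f : N (fun x => step_fun (g n) x - phi x * f x) @[n --> \oo] --> 0.
  pose Fn n x := \sum_(p <- L n) p.1 * (f x * \1_`[0, p.2] x).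
  have Fn2 n : square_integrable mu `[0, T] (Fn n).
    apply: (square_integrable_sum mT) => // p _; apply: (square_integrableZ mT).
    exact: square_integrable_indic.
  apply/cvgrPdist_le => e e0; have Nf0 := integral_sqr_ge0 mu `[0, T] f.
  (* The second argument makes dl (N f) at most e / 4, and the cap at 1 gives dl^2 <= dl. *)
  pose dl := Num.min 1 (e / (4 * (N f + 1))).
  have dl0 : 0 < dl by rewrite lt_min ltr01 divr_gt0// mulr_gt0// ltr_wpDl.
  have dlN : 2 * (dl ^+ 2 * N f) <= e / 2.
    have d1 : dl <= 1 by rewrite ge_min lexx.
    have d2 : dl * (4 * (N f + 1)) <= e.
      by rewrite -ler_pdivlMr ?mulr_gt0 ?ltr_wpDl// ge_min lexx orbT.
    have d3 : dl ^+ 2 <= dl by rewrite expr2 ler_piMr// ltW.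
    have := ler_wpM2r Nf0 d3; nra.
  near=> n; rewrite sub0r normrN ger0_norm ?integral_sqr_ge0//.
  have [wn _ gn] := hg n.
  have -> : N (fun x => step_fun (g n) x - phi x * f x) =
      N (fun x => 1 * (step_fun (g n) x - Fn n x) + (Fn n x - phi x * f x)).
    by apply: eq_Rintegral => x _; rewrite mul1r addrA subrK.
  have E1 : square_integrable mu `[0, T] (fun x => step_fun (g n) x - Fn n x).
    by apply: (square_integrableB mT) => //; exact: step_fun_square_integrable.
  have E2 : square_integrable mu `[0, T] (fun x => Fn n x - phi x * f x).
    exact: (square_integrableB mT).
  apply: le_trans (integral_sqrD_le mT 1 E1 E2) _.
  have h1 : 2^-1 ^+ n.+1 <= e / 4.
    apply: le_trans (ler_norm _) _; apply: ltW; near: n.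
    by apply: cvgr0_norm_lt half0 _ _; rewrite divr_gt0.
  suff : N (fun x => Fn n x - phi x * f x) <= dl ^+ 2 * N f.
    move=> h2; have ee : e = 2 * (e / 4) + e / 2 by field.
    rewrite expr1n mulr1 [leRHS]ee; apply: lerD.
      by apply: ler_wpM2l => //; exact: le_trans gn h1.
    by apply: le_trans dlN; exact: ler_wpM2l.
  rewrite -RintegralZl//; last by case: f2.
  apply: le_Rintegral => //; first by case: E2.
    by case: f2 => _ f2; exact: (integrableZl _ (dl ^+ 2) f2).
  move=> x; rewrite /= in_itv/= => xT.
  have FnE : Fn n x = f x * (phi 0 * mesh_indic T n 0 x +
      \sum_(i < n.+1) phi (mesh T n i) * (mesh_indic T n i.+1 x - mesh_indic T n i x)).
    rewrite /Fn (sumL n (fun t => f x * \1_`[0, t] x)) mulrDr mulr_sumr.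
    rewrite /mesh_indic; congr (_ + _); first by ring.
    by apply: eq_bigr => i _; ring.
  rewrite FnE (mulrC (phi x)) -mulrBr exprMn mulrC ler_wpM2r ?sqr_ge0//.
  rewrite -(real_normK (num_real (_ - _))) lerXn2r ?nnegrE ?(ltW dl0)//.
  apply: mesh_indic_close => //.
  by near: n; exact: uniformly_continuous_itv.
pose Z w := c * (X T w - fund_mean I C).
have TT : 0 <= T <= T by rewrite T0 lexx.
have mXT : measurable_fun setT (X T) by exact: (adapted_measurable hF aX TT).
have mZ : measurable_fun setT Z.
  by apply: measurable_funM => //; exact: measurable_funB.
have mM t : 0 <= t <= T -> measurable_fun setT (M t) by move=> /itoM[].
have SZ : {ae P, forall w, step_ito B (g n) w @[n --> \oo] --> Z w}.
  have D0 : {ae P, forall w, setT w -> \sum_(p <- L n) p.1 * M p.2 w - step_ito B (g n) w @[n --> \oo] --> 0}.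
    apply: ae_cvg0_of_summable_sqr => // n; last by have [] := hg n.
    apply: measurable_funB; last first.
      by apply: (measurable_step_ito hF hB) => //; have [] := hg n.
    apply: measurable_sum_mem => p /LT pT; apply: measurable_funM => //.
    exact: mM.
  apply: filterS3 D0 cX sde => w Dw cw sw.
  have := cvg_discounted_noise aIC cw sw => hw.
  have {}hw : \sum_(p <- L n) p.1 * M p.2 w @[n --> \oo] --> Z w.
    have : c * (expR (rate m * T) * M 0 w + \sum_(i < n.+1) expR (rate m * (T - mesh T n i)) *
     (M (mesh T n i.+1) w - M (mesh T n i) w)) @[n --> \oo] --> Z w by exact: cvgMr.
    apply: cvg_trans; apply: near_eq_cvg; apply: nearW => n /=.
    rewrite (sumL n (M^~ w)) mulrDr mulr_sumr mesh0 /phi subr0 mulrA; congr (_ + _).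
    by apply: eq_bigr => i _; rewrite mulrA.
  have : \sum_(p <- L n) p.1 * M p.2 w - (\sum_(p <- L n) p.1 * M p.2 w - step_ito B (g n) w)
      @[n --> \oo] --> (Z w - 0 : R).
    by apply: cvgB => //; exact: Dw.
  rewrite subr0; apply: cvg_trans; apply: near_eq_cvg; apply: nearW => n /=.
  by rewrite opprB addrC subrK.
have := ito_mgf_limit hF hB T0 (fun n => let: And3 h _ _ := hg n in h) phif2 g_f mZ SZ.
have -> : N (fun x => phi x * f x) = c ^+ 2 * fund_var I.
  rewrite /fund_var mulrA -RintegralZl//.
    apply: eq_Rintegral => x _; rewrite /phi /f.
    rewrite (_ : 2 * rate m * (T - x) = r * (T - x) + r * (T - x)); last by rewrite /r; ring.
    by rewrite expRD; ring.
  have e2 : {within `[0, T], continuous (fun t => expR (2 * rate m * (T - t)))}.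
    by apply: continuous_subspaceT; exact: continuous_expR_lin.
  by case: I2 => _ I2; exact: integrable_continuousM e2 I2.
move=> ZE; rewrite expRD EFinM -ZE -ge0_integralZl//; last first.
  by apply/measurable_EFinP; exact: measurableT_comp.
apply: eq_integral => w _; rewrite -EFinM -expRD /Z; congr (expR _)%:E; ring.
Unshelve. all: by end_near. Qed.

End fund_law.

(** * Existence of fund processes *)

Section ito_integral_limit.
Context d (Omega : measurableType d) (R : realType) (P : probability Omega R).
Variables (T : R) (F : R -> set (set Omega)) (B : R -> Omega -> R).
Notation mu := (@lebesgue_measure R).

(** This and [brownian_motion_le] allow any intermediate time to be taken as the horizon. *)
Lemma complete_filtration_le t : t <= T -> complete_filtration P T F ->
  complete_filtration P t F.
Proof.
move=> tT [h1 h2 h3 h4]; split => //.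
- by move=> s /andP[s0 st]; apply: h1; rewrite s0 (le_trans st).
- by move=> s /andP[s0 st]; apply: h2; rewrite s0 (le_trans st).
- by move=> s u s0 su ut; apply: h3 => //; exact: le_trans ut tT.
Qed.

Lemma within_continuous_sub (a b a' b' : R) (f : R -> R) : a' <= a -> b <= b' ->
  {within `[a', b'], continuous f} -> {within `[a, b], continuous f}.
Proof.
move=> aa bb; apply: continuous_subspaceW => x /=; rewrite !in_itv/=; lra.
Qed.

Lemma brownian_motion_le t : t <= T -> brownian_motion P T F B ->
  brownian_motion P t F B.
Proof.
move=> tT [h1 h2 h3 h4 h5]; split => //.
- by move=> s /andP[s0 st]; apply: h1; rewrite s0 (le_trans st).
- by apply: filterS h3 => w; exact: within_continuous_sub.
- by move=> s u s0 su ut; apply: h4 => //; exact: le_trans ut tT.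
- by move=> s u s0 su ut; apply: h5 => //; exact: le_trans ut tT.
Qed.

Hypothesis hF : complete_filtration P T F.
Hypothesis hB : brownian_motion P T F B.
Hypothesis T0 : 0 <= T.
Local Notation N f := (\int[mu]_(x in `[0, T]) (f x ^+ 2)).

Let mT : measurable (`[0, T]%classic : set (measurableTypeR R)).
Proof. exact: measurable_itv. Qed.

(** Upgrades almost sure convergence of the step integrals to convergence in L^2(P): Fatou's lemma
    on (S_k - S_n)^2 as k tends to infinity, with [step_ito_sqr_le] as upper bound, leaves a
    quantity governed by the distance from g_n to f. *)
Lemma ito_integral_of_cvg (g : nat -> seq (R * R * R)) (f : R -> R) (Y : Omega -> R) :
  (forall n, step_wf T (g n)) -> square_integrable mu `[0, T] f ->
  N (fun x => step_fun (g n) x - f x) @[n --> \oo] --> 0 ->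
  measurable_fun setT Y ->
  {ae P, forall w, step_ito B (g n) w @[n --> \oo] --> Y w} ->
  ito_integral P B T f Y.
Proof.
move=> wg f2 gf mY SY; split => //; exists g.
have g2 n : square_integrable mu `[0, T] (step_fun (g n)) by exact: step_fun_square_integrable.
split => //.
  have : (N (fun x => step_fun (g n) x - f x))%:E @[n --> \oo] --> 0%E.
    by apply: cvg_EFin => //; exact: nearW.
  apply: cvg_trans; apply: near_eq_cvg; apply: nearW => n.
  rewrite /Rintegral fineK// integrable_fin_num//.
  by have [] := square_integrableB mT (g2 n) f2.
have mS n : measurable_fun setT (step_ito B (g n)) by apply: (measurable_step_ito hF hB).
pose bd n : R := 8 * (expR (2^-1 * N (fun x => f x - step_fun (g n) x)) - 1).
have Pbd n : ('E_P[(fun w => (Y w - step_ito B (g n) w) ^+ 2)%R] <= (bd n)%:E)%E.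
  rewrite unlock; pose gk k := step_scale (-1) (g n) ++ g k.
  have wgk k : step_wf T (gk k) by apply: step_wf_cat => //; exact: step_wf_scale.
  apply: (@fatou_le _ _ _ _ _ _ (fun k w => step_ito B (gk k) w ^+ 2) _
    (fun k => 8 * (expR (2^-1 * N (step_fun (gk k))) - 1))) => //.
  - by move=> k; apply: measurable_funX; apply: (measurable_step_ito hF hB).
  - by apply: measurable_funX; exact: measurable_funB.
  - by move=> k w _; rewrite sqr_ge0.
  - by move=> w _; rewrite sqr_ge0.
  - by move=> k; apply: (step_ito_sqr_le hF hB).
  - apply: filterS SY => w hw _.
    have : step_ito B (gk k) w @[k --> \oo] --> (Y w - step_ito B (g n) w : R).
      under eq_fun do rewrite step_ito_cat step_ito_scale mulN1r addrC.
      by apply: cvgB => //; exact: cvg_cst.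
    by move=> h; under eq_fun do rewrite expr2; rewrite expr2; exact: cvgM.
  - apply: cvgMr; apply: cvgB; last exact: cvg_cst.
    apply: cvg_expR_half; apply: (cvg_integral_sqr mT).
    + by move=> k; exact: step_fun_square_integrable.
    + exact: (square_integrableB mT).
    apply: cvg_trans gf; apply: near_eq_cvg; apply: nearW => k.
    by apply: eq_Rintegral => x _; rewrite step_fun_cat step_fun_scale; congr (_ ^+ 2); ring.
have bd0 : (bd n)%:E @[n --> \oo] --> 0%E.
  apply: cvg_EFin; first exact: nearW.
  have : 8 * (expR (2^-1 * N (fun x => step_fun (g n) x - f x)) - 1) @[n --> \oo] --> (8 * (expR (2^-1 * 0) - 1) : R).
    by apply: cvgMr; apply: cvgB; [exact: cvg_expR_half|exact: cvg_cst].
  rewrite mulr0 expR0 subrr mulr0; apply: cvg_trans; apply: near_eq_cvg; apply: nearW => n.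
  rewrite /bd; congr (8 * (expR (2^-1 * _) - 1)).
  by apply: eq_Rintegral => x _; ring.
apply: squeeze_cvge (cvg_cst 0%E) bd0; apply: nearW => n; rewrite Pbd andbT.
by rewrite unlock; apply: integral_ge0 => w _; rewrite lee_fin sqr_ge0.
Qed.

End ito_integral_limit.

(** * Pathwise stochastic integrals of C^1 integrands *)

Section integration_by_parts_ito.
Context d (Omega : measurableType d) (R : realType) (P : probability Omega R).
Variables (T : R) (F : R -> set (set Omega)) (B : R -> Omega -> R).
Notation mu := (@lebesgue_measure R).
Hypothesis hF : complete_filtration P T F.
Hypothesis hB : brownian_motion P T F B.
Hypothesis T0 : 0 <= T.

Lemma measurable_wrt_cvg (G : set (set Omega)) (X_ : nat -> Omega -> R) (X : Omega -> R) :
  sigma_algebra setT G -> (forall n, measurable_wrt G (X_ n)) ->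
  (forall w, X_ n w @[n --> \oo] --> X w) -> measurable_wrt G X.
Proof.
move=> sG mX X_X; apply/(measurable_wrtP _ sG).
apply: (@measurable_fun_cvg _ (g_sigma_algebraType G) _ _ X_) => //.
by move=> n; apply/(measurable_wrtP _ sG).
Qed.

(** For every w the integral is the limit of tagged sums over times up to t, each of them measurable
    for [F t], and measurability passes to pointwise limits. *)
Lemma adapted_integral (Y : R -> Omega -> R) (k : R -> R) t : adapted T F Y ->
  (forall w, {within `[0, T], continuous (Y^~ w)}) ->
  mu.-integrable `[0, T] (EFin \o k) -> 0 <= t <= T ->
  measurable_wrt (F t) (fun w => \int[mu]_(s in `[0, t]) (Y s w * k s)).
Proof.
move=> aY cY ik tT; have /andP[t0 tT1] := tT; have sF := filtration_sigma_algebra hF tT.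
apply: (@measurable_wrt_cvg _ (fun n w => \sum_(i < n.+1)
    Y (mesh t n i) w * \int[mu]_(s in `[mesh t n i, mesh t n i.+1]) k s)) => //.
  move=> n; apply: measurable_wrt_sum => // i _.
  apply: measurable_wrtM => //; last exact: measurable_wrt_cst.
  have /andP[m0 mt] := mesh_bound t0 (ltnW (ltn_ord i)).
  exact: (adapted_wrt hF aY).
move=> w; apply: (cvg_tagged_sum (q := Y^~ w) (xi := mesh t) t0).
- exact: within_continuous_sub (cY w).
- exact: integrable_subitv ik.
- by move=> n i; rewrite lexx mesh_leS.
Qed.

Let irregular := ~` [set w | {within `[0, T], continuous (B^~ w)}].

Let irregular_negligible : P.-negligible irregular.
Proof. by case: hB => _ _ + _ _. Qed.

(** Brownian paths are continuous only almost surely, whereas the pathwise integrals use every path.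
    The exceptional paths are replaced by 0; they form a negligible set, which belongs to [F 0] by
    completeness, so adaptedness survives. *)
Definition regular_bm t w : R := if w \in irregular then 0 else B t w.

Lemma regular_bm_continuous w : {within `[0, T], continuous (regular_bm^~ w)}.
Proof.
rewrite /regular_bm; have [wN|wN] := boolP (w \in irregular).
  by apply: continuous_subspaceT; exact: cst_continuous.
by move: wN; rewrite notin_setE => /contrapT.
Qed.

Lemma regular_bm_eq : {ae P, forall w, forall t, regular_bm t w = B t w}.
Proof.
apply: negligibleS irregular_negligible => w /= h wN; apply: h => t.
by rewrite /regular_bm memNset.
Qed.

Lemma regular_bm_adapted : adapted T F regular_bm.
Proof.
move=> t tT; have sF := filtration_sigma_algebra hF tT; have /andP[t0 tT1] := tT.
have FN : F t irregular.
  by case: hF => _ _ h3 h4; apply: (h3 0 t) => //; exact: h4.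
have aB : measurable_wrt (F t) (B t) := bm_adapted hB tT.
have -> : regular_bm t = (fun w => \1_(~` irregular) w * B t w).
  apply/funext => w; rewrite /regular_bm indicE in_setC.
  by case: (w \in irregular); rewrite ?mul0r ?mul1r.
apply: measurable_wrtM => //; apply/(measurable_wrtP _ sF).
apply: measurable_indic; apply: measurableC.
by rewrite /measurable/=; exact: sub_sigma_algebra.
Qed.

Variables (h h' : R -> R).
Hypothesis dh : forall x : R, is_derive x (1 : R) h (h' x).
Hypothesis ch' : continuous h'.

Let ch : continuous h.
Proof.
move=> x; apply: differentiable_continuous; apply/derivable1_diffP.
by have [] := dh x.
Qed.

(** Integration by parts taken as a definition: it makes sense for each path, and adaptedness and
    continuity in t can be read off it. [ito_wiener_integral] identifies it with the Ito
    integral. *)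
Definition wiener_integral t w : R := h t * regular_bm t w - h 0 * regular_bm 0 w
  - \int[mu]_(s in `[0, t]) (regular_bm s w * h' s).

Let ih' a b : mu.-integrable `[a, b] (EFin \o h').
Proof. by apply: integrable_within_continuous; exact: continuous_subspaceT. Qed.

Lemma wiener_integral_adapted : adapted T F wiener_integral.
Proof.
move=> t tT; have sF := filtration_sigma_algebra hF tT; have /andP[t0 tT1] := tT.
have rw s : 0 <= s -> s <= t -> measurable_wrt (F t) (regular_bm s).
  by move=> s0 st; exact: (adapted_wrt hF regular_bm_adapted).
have -> : wiener_integral t = (fun w => h t * regular_bm t w + (- h 0 * regular_bm 0 w
    + -1 * \int[mu]_(s in `[0, t]) (regular_bm s w * h' s))).
  by apply/funext => w; rewrite /wiener_integral; ring.
apply: measurable_wrtD => //; first by apply: measurable_wrtZ => //; exact: rw.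
apply: measurable_wrtD => //; first by apply: measurable_wrtZ => //; exact: rw.
apply: measurable_wrtZ => //; apply: adapted_integral => //.
- exact: regular_bm_adapted.
- exact: regular_bm_continuous.
Qed.

Lemma ito_wiener_integral t : 0 <= t <= T -> ito_integral P B t h (wiener_integral t).
Proof.
move=> tT; have /andP[t0 tT1] := tT.
pose g n : seq (R * R * R) :=
  [seq (h (mesh t n i), mesh t n i, mesh t n i.+1) | i : 'I_n.+1 <- enum 'I_n.+1].
have stepE n x : step_fun (g n) x = \sum_(i < n.+1) h (mesh t n i) * \1_`]mesh t n i, mesh t n i.+1] x.
  by rewrite /step_fun big_map big_enum.
have itoE n w : step_ito B (g n) w =
    \sum_(i < n.+1) h (mesh t n i) * (B (mesh t n i.+1) w - B (mesh t n i) w).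
  by rewrite /step_ito big_map big_enum.
have wg n : step_wf t (g n).
  move=> a s u /mapP[i _ [_ -> ->]]; split; last by have /andP[] := mesh_bound t0 (ltn_ord i).
  - by have /andP[] := mesh_bound t0 (ltnW (ltn_ord i)).
  - exact: mesh_leS.
have h2 : square_integrable mu `[0, t] h.
  by apply: square_integrable_continuous; exact: continuous_subspaceT.
apply: (ito_integral_of_cvg (complete_filtration_le tT1 hF) (brownian_motion_le tT1 hB) t0 wg h2).
- apply/cvgrPdist_le => e e0; pose K := \int[mu]_(x in `[0, t]) (1 : R).
  have K0 : 0 <= K by apply: Rintegral_ge0.
  have ione (c : R) : mu.-integrable `[0, t] (EFin \o cst c).
    by apply: integrable_within_continuous; apply: continuous_subspaceT; exact: cst_continuous.
  pose dl := Num.min 1 (e / (K + 1)).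
  have dl0 : 0 < dl by rewrite lt_min ltr01 divr_gt0// ltr_wpDl.
  have dlK : dl ^+ 2 * K <= e.
    have d1 : dl <= 1 by rewrite ge_min lexx.
    have d2 : dl * (K + 1) <= e by rewrite -ler_pdivlMr ?ltr_wpDl// ge_min lexx orbT.
    have d3 : dl ^+ 2 <= dl by rewrite expr2 ler_piMr// ltW.
    have := ler_wpM2r K0 d3; nra.
  near=> n; rewrite sub0r normrN ger0_norm ?integral_sqr_ge0//; apply: le_trans dlK.
  have s2 : square_integrable mu `[0, t] (fun x => step_fun (g n) x - h x).
    by apply: square_integrableB => //; exact: step_fun_square_integrable.
  (* The point 0 is discarded because the step function, supported in half-open intervals, vanishes
     there while [h 0] need not. *)
  have i2 : mu.-integrable `]0, t] (EFin \o (fun x => (step_fun (g n) x - h x) ^+ 2)).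
    by case: s2 => _; apply: integrableS => //; exact: subset_itv_oc_cc.
  have i1 : mu.-integrable `]0, t] (EFin \o (fun=> dl ^+ 2)).
    by apply: integrableS (ione (dl ^+ 2)) => //; exact: subset_itv_oc_cc.
  rewrite -Rintegral_itv_obnd_cbnd// -RintegralZl//; last exact: ione.
  rewrite [leRHS](@eq_Rintegral _ _ _ _ _ (fun=> dl ^+ 2)); last by move=> x _; rewrite mulr1.
  rewrite -[leRHS]Rintegral_itv_obnd_cbnd//; apply: le_Rintegral => //.
  move=> x; rewrite /= in_itv/= => /andP[x0 xt].
  rewrite -(real_normK (num_real (_ - _))) lerXn2r ?nnegrE ?(ltW dl0)//.
  have -> : step_fun (g n) x = h 0 * mesh_indic t n 0 x
      + \sum_(i < n.+1) h (mesh t n i) * (mesh_indic t n i.+1 x - mesh_indic t n i x).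
    rewrite stepE /mesh_indic mesh0 [\1__ x]indicE memNset ?mulr0 ?add0r; last first.
      by rewrite /= in_itv/= (ltW x0)/= leNgt x0.
    apply: eq_bigr => i _; congr (_ * _); rewrite !indicE !mem_setE !in_itv/= (ltW x0)/=.
    have := mesh_leS n i t0; case: (leP x (mesh t n i)) => [xi /(le_trans xi) ->|_ _].
      by rewrite subrr.
    by rewrite subr0.
  apply: mesh_indic_close => //; first by rewrite (ltW x0).
  near: n; apply: uniformly_continuous_itv => //; exact: continuous_subspaceT.
- exact: (adapted_measurable hF wiener_integral_adapted).
- apply: filterS regular_bm_eq => w rw.
  have cB : {within `[0, t], continuous (regular_bm^~ w)}.
    by apply: (within_continuous_sub (lexx 0) tT1); exact: regular_bm_continuous.
  (* Summation by parts turns the step integral of [h] into the boundary terms minus a sum of B at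
     right endpoints against the increments of [h]. *)
  have c1 := cvg_tagged_sum (xi := fun n i => mesh t n i.+1) t0 cB (@ih' 0 t)
    (fun n i => introT andP (conj (mesh_leS n i t0) (lexx _))).
  have : h t * regular_bm t w - h 0 * regular_bm 0 w - \sum_(i < n.+1) regular_bm (mesh t n i.+1) w *
     \int[mu]_(u in `[mesh t n i, mesh t n i.+1]) h' u @[n --> \oo] --> (wiener_integral t w : R).
    by apply: cvgB => //; exact: cvg_cst.
  apply: cvg_trans; apply: near_eq_cvg; apply: nearW => n; rewrite itoE.
  have -> : h t * regular_bm t w - h 0 * regular_bm 0 w = \sum_(i < n.+1)
    (h (mesh t n i.+1) * regular_bm (mesh t n i.+1) w - h (mesh t n i) * regular_bm (mesh t n i) w).
    rewrite -(big_mkord xpredT (fun i => h (mesh t n i.+1) * regular_bm (mesh t n i.+1) w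
      - h (mesh t n i) * regular_bm (mesh t n i) w)).
    by rewrite telescope_sumr// meshn mesh0.
  rewrite -sumrB; apply: eq_bigr => i _.
  rewrite (Rintegral_is_derive (mesh_leS n i t0) dh ch') !rw; ring.
Unshelve. all: by end_near. Qed.

End integration_by_parts_ito.

(** * Solution of the linear fund equation *)

Section fund_existence.
Context {R : realType} (m : model R).
Context d (Omega : measurableType d) (P : probability Omega R).
Variables (F : R -> set (set Omega)) (B : R -> Omega -> R).
Local Notation T := (horizon m).
Notation mu := (@lebesgue_measure R).
Hypothesis hF : complete_filtration P T F.
Hypothesis hB : brownian_motion P T F B.
Hypothesis T0 : 0 <= T.

Lemma within_continuous_integral (f : R -> R) a b : a <= b ->
  mu.-integrable `[a, b] (EFin \o f) ->
  {within `[a, b], continuous (fun t => \int[mu]_(s in `[a, t]) f s)}.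
Proof. exact: parameterized_integral_continuous. Qed.

Lemma within_continuousD (f g : R -> R) (A : set R) : {within A, continuous f} ->
  {within A, continuous g} -> {within A, continuous (fun x => f x + g x)}.
Proof. by move=> cf cg x; apply: cvgD; [exact: cf|exact: cg]. Qed.

Lemma within_continuousM (f g : R -> R) (A : set R) : {within A, continuous f} ->
  {within A, continuous g} -> {within A, continuous (fun x => f x * g x)}.
Proof. by move=> cf cg x; apply: cvgM; [exact: cf|exact: cg]. Qed.

(* Variation of constants for X = G + r \int X. *)
Lemma variation_of_constants (r t : R) (G : R -> R) : 0 <= t ->
  {within `[0, t], continuous G} ->
  let J s := \int[mu]_(u in `[0, s]) (G u * expR (r * (0 - u))) in
  let X s := G s + r * (expR (- r * (0 - s)) * J s) in
  \int[mu]_(s in `[0, t]) X s = expR (- r * (0 - t)) * J t.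
Proof.
rewrite le_eqVlt => /predU1P[<- _|t0 cG] J X.
  by rewrite set_itv1 /J set_itv1 !Rintegral_set1 mulr0.
(* Exponentials are written with [0 - s] to reuse the derivative of e^(r(T - u)) at T = 0. *)
have cE (r' : R) (A : set R) : {within A, continuous (fun s => expR (r' * (0 - s)))}.
  by apply: continuous_subspaceT; exact: continuous_expR_lin.
have cGE : {within `[0, t], continuous (fun u => G u * expR (r * (0 - u)))}.
  by apply: within_continuousM => //; exact: cE.
have iGE := integrable_within_continuous cGE.
have cJ : {within `[0, t], continuous J} by exact: within_continuous_integral (ltW t0) iGE.
have cY : {within `[0, t], continuous (fun s => expR (- r * (0 - s)) * J s)}.
  by apply: within_continuousM => //; exact: cE.
have cX : {within `[0, t], continuous X}.
  apply: within_continuousD => //; apply: within_continuousM => //.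
  by apply: continuous_subspaceT; exact: cst_continuous.
have dY x : x \in `]0, t[ -> is_derive x (1 : R) (fun s => expR (- r * (0 - s)) * J s) (X x).
  rewrite in_itv/= => /andP[x0 xt].
  have cx : {for x, continuous (fun u => G u * expR (r * (0 - u)))}.
    have [+ _ _] := (continuous_within_itvP _ t0).1 cGE.
    by apply; rewrite in_itv/= x0.
  have [dJ J'] := continuous_FTC1_closed xt iGE x0 cx.
  have isJ : is_derive x (1 : R) J (G x * expR (r * (0 - x))).
    by apply: DeriveDef; [exact: dJ|rewrite -derive1E; exact: J'].
  apply: is_derive_eq (is_deriveM (is_derive_expR_lin (- r) 0 x) isJ) _.
  rewrite /X /GRing.scale/= opprK.
  have E1 : expR (- r * (0 - x)) * expR (r * (0 - x)) = 1.
    by rewrite -expRD -mulrDl addNr mul0r expR0.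
  by rewrite [_ * (G x * _)]mulrCA E1; ring.
rewrite /Rintegral (@continuous_FTC2 _ X (fun s => expR (- r * (0 - s)) * J s))//.
- by rewrite {2}/J set_itv1 Rintegral_set1 mulr0 sube0.
- have [_ c0 ct] := (continuous_within_itvP _ t0).1 cY; split; [|exact: c0|exact: ct].
  by move=> x xt; have [] := dY x xt.
- by move=> x xt; rewrite derive1E; have h := dY x xt; exact: derive_val.
Qed.

(** The noise does not involve X, so along each path the equation reads X = G + r \int X with G
    known, and variation of constants solves it. The derivative I' makes the noise itself a pathwise
    expression. *)
Lemma fund_process_exists (I I' C : R -> R) :
  (forall x : R, is_derive x (1 : R) I (I' x)) -> continuous I' -> continuous C ->
  exists X, fund_process m P F B I C X.
Proof.
move=> dI cI' cC.
pose h x := volatility m * I x; pose h' x := volatility m * I' x.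
have dh (x : R) : is_derive x (1 : R) h (h' x) by exact: is_deriveZ.
have ch' : continuous h' by move=> x; apply: cvgMr; exact: cI'.
have cI : continuous I.
  move=> x; apply: differentiable_continuous; apply/derivable1_diffP.
  by have [] := dI x.
pose a s := excess m * I s - C s.
have ca : continuous a.
  by move=> x; apply: cvgB; [apply: cvgMr; exact: cI|exact: cC].
have ia : mu.-integrable `[0, T] (EFin \o a).
  by apply: integrable_within_continuous; exact: continuous_subspaceT.
pose M := wiener_integral T B h h'.
pose r := rate m.
pose G t w := (fund0 m + \int[mu]_(s in `[0, t]) a s) + M t w.
pose X t w := G t w + r * (expR (- r * (0 - t)) * \int[mu]_(s in `[0, t]) (G s w * expR (r * (0 - s)))).
have cst_c (c : R) (A : set R) : {within A, continuous (fun=> c)}.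
  by apply: continuous_subspaceT; exact: cst_continuous.
have cM w : {within `[0, T], continuous (M^~ w)}.
  have cb : {within `[0, T], continuous (fun s => regular_bm T B s w)}.
    exact: regular_bm_continuous.
  have ch : continuous h by move=> x; apply: cvgMr; exact: cI.
  have i' : mu.-integrable `[0, T] (EFin \o (fun s => regular_bm T B s w * h' s)).
    apply: integrable_within_continuous; apply: within_continuousM => //.
    exact: continuous_subspaceT.
  have -> : M^~ w = (fun t => (h t * regular_bm T B t w + - (h 0 * regular_bm T B 0 w))
      + (-1) * \int[mu]_(s in `[0, t]) (regular_bm T B s w * h' s)).
    by apply/funext => t; rewrite /M /wiener_integral; ring.
  apply: within_continuousD.
    apply: within_continuousD => //; apply: within_continuousM => //.
    exact: continuous_subspaceT.
  by apply: within_continuousM => //; exact: within_continuous_integral.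
have cG w : {within `[0, T], continuous (G^~ w)}.
  apply: within_continuousD => //; apply: within_continuousD => //.
  exact: within_continuous_integral.
have aG : adapted T F G.
  move=> t tT; have sF := filtration_sigma_algebra hF tT.
  apply: measurable_wrtD => //; first exact: measurable_wrt_cst.
  exact: (wiener_integral_adapted hF hB h ch').
have cE (r' : R) (A : set R) : {within A, continuous (fun s => expR (r' * (0 - s)))}.
  by apply: continuous_subspaceT; exact: continuous_expR_lin.
have cX w : {within `[0, T], continuous (X^~ w)}.
  apply: within_continuousD => //; apply: within_continuousM => //.
  apply: within_continuousM => //; apply: within_continuous_integral => //.
  by apply: integrable_within_continuous; apply: within_continuousM.
exists X; split.
- move=> t tT; have sF := filtration_sigma_algebra hF tT.
  apply: measurable_wrtD => //; first exact: aG.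
  apply: measurable_wrtZ => //; apply: measurable_wrtZ => //.
  by apply: (adapted_integral hF) => //; apply: integrable_within_continuous; exact: cE.
- exact: aeW.
- exists M; first by move=> t tT; exact: (ito_wiener_integral hF hB).
  apply: aeW => w t tT; have /andP[t0 tT1] := tT.
  have cGt : {within `[0, t], continuous (G^~ w)} by exact: within_continuous_sub (cG w).
  have V := variation_of_constants r t0 cGt.
  have iXt : mu.-integrable `[0, t] (EFin \o X^~ w).
    by apply: integrable_within_continuous; exact: within_continuous_sub (cX w).
  have -> : \int[mu]_(s in `[0, t]) (rate m * X s w + excess m * I s - C s) =
      rate m * \int[mu]_(s in `[0, t]) X s w + \int[mu]_(s in `[0, t]) a s.
    rewrite -RintegralZl// -RintegralD//.
    + by apply: eq_Rintegral => s _; rewrite /a addrA.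
    + exact: (integrableZl _ (rate m) iXt).
    + exact: integrable_subitv ia.
  rewrite {2}/X V -/r /X /G; ring.
Qed.

End fund_existence.

(** * The deterministic optimisation problem *)

Section optimality.
Context {R : realType} (m : model R).
Local Notation r := (rate m).
Local Notation v := (excess m).
Local Notation sigma := (volatility m).
Local Notation T := (horizon m).
Local Notation alpha1 := (risk1 m).
Local Notation alpha2 := (risk2 m).
Local Notation beta1 := (diminish m).
Local Notation gamma1 := (weight m).
Local Notation rho := (decay m).
Local Notation theta := (herd m).
Notation mu := (@lebesgue_measure R).
Hypothesis hr : r != 0.
Hypothesis hsigma : 0 < sigma.
Hypothesis hT : 0 < T.
Hypothesis halpha1 : 0 < alpha1.
Hypothesis halpha2 : 0 < alpha2.
Hypothesis hbeta1 : 0 < beta1.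
Hypothesis hgamma1 : 0 < gamma1.
Hypothesis htheta : 0 <= theta.

Let mT : measurable (`[0, T]%classic : set (measurableTypeR R)).
Proof. exact: measurable_itv. Qed.

Let within_expR_lin (a : R) : {within `[0, T], continuous (fun t => expR (a * (T - t)))}.
Proof. by apply: continuous_subspaceT; exact: continuous_expR_lin. Qed.

(** By [fund_mgf] this is the logarithm of E exp(- alpha1 X_T); its value at the candidate is ln
    eta. *)
Definition exponent (I C : R -> R) : R :=
  - alpha1 * fund_mean m I C + 2^-1 * (alpha1 ^+ 2 * fund_var m I).

Definition objective_real (I C : R -> R) : R :=
  - alpha1^-1 * expR (exponent I C) +
  (gamma1 * \int[mu]_(t in `[0, T]) (consumption_utility m t (C t))
   - theta * average_deviation m I (rational_investment m alpha2)).

(** The value does not depend on which fund process is chosen, and from here on the problem is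
    deterministic. *)
Lemma objectiveE d (Omega : measurableType d) (P : probability Omega R)
    (F : R -> set (set Omega)) (B : R -> Omega -> R) I C X :
  complete_filtration P T F -> brownian_motion P T F B ->
  admissible m I C -> fund_process m P F B I C X ->
  objective m P I C X = (objective_real I C)%:E.
Proof.
move=> hF hB aIC fX; rewrite /objective /objective_real [RHS]EFinD; congr (_ + _)%E.
have E := fund_mgf hF hB (ltW hT) (- alpha1) aIC fX.
rewrite unlock sqrrN in E *; rewrite /exponent EFinM -E -integralZl//.
apply/integrableP; split.
  apply/measurable_EFinP; apply: measurableT_comp => //.
  apply: measurable_funM => //; have [aX _ _] := fX.
  by apply: (adapted_measurable hF aX); rewrite ltW//= lexx.
under eq_integral do rewrite gee0_abs ?lee_fin ?expR_ge0//.
by rewrite E ltry.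
Qed.

Section integrands.
Variables (I C : R -> R).
Hypothesis aIC : admissible m I C.

Lemma mean_integrable : mu.-integrable `[0, T]
  (EFin \o (fun t => expR (r * (T - t)) * (v * I t - C t))).
Proof.
by apply: integrable_continuousM (admissible_drift_integrable aIC); exact: within_expR_lin.
Qed.

Lemma var_integrable : mu.-integrable `[0, T]
  (EFin \o (fun t => expR (2 * r * (T - t)) * I t ^+ 2)).
Proof. by case: aIC => _ I2 _ _; apply: (integrable_continuousM _ I2); exact: within_expR_lin. Qed.

Lemma continuous_rational_investment (a : R) : continuous (rational_investment m a).
Proof.
move=> t; apply: cvgMr.
rewrite (_ : (fun t => _) = (fun t => expR (- r * (T - t)))); last first.
  by apply/funext => s; congr expR; ring.
by rewrite (_ : r * (t - T) = - r * (T - t)); [exact: continuous_expR_lin|ring].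
Qed.

Lemma rational_investment_square_integrable (a : R) :
  square_integrable mu `[0, T] (rational_investment m a).
Proof.
apply: square_integrable_continuous; apply: continuous_subspaceT.
exact: continuous_rational_investment.
Qed.

Lemma deviation_integrable : mu.-integrable `[0, T]
  (EFin \o (fun t => expR (rho * r * (T - t)) * (I t - rational_investment m alpha2 t) ^+ 2)).
Proof.
have [_ d2] := square_integrableB mT (admissible_square_integrable aIC)
  (rational_investment_square_integrable alpha2).
by apply: (integrable_continuousM _ d2); exact: within_expR_lin.
Qed.

Lemma consumption_utility_integrable : mu.-integrable `[0, T]
  (EFin \o (fun t => consumption_utility m t (C t))).
Proof.
case: aIC => _ _ iC C0; pose g t := beta1^-1 * expR (- rho * r * t).
have cg : continuous g.
  move=> t; apply: cvgMr.
  rewrite (_ : (fun t => _) = (fun t => expR (rho * r * (0 - t)))); last first.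
    by apply/funext => s; congr expR; ring.
  by rewrite (_ : - rho * r * t = rho * r * (0 - t)); [exact: continuous_expR_lin|ring].
apply: (integrable_dominated mT (g := g)).
- apply: measurable_funM => //; apply: measurableT_comp => //.
  apply: measurable_funB; first exact: measurable_funM.
  by apply: measurable_funM => //; apply/measurable_EFinP; exact: measurable_int iC.
- by apply: integrable_within_continuous; exact: continuous_subspaceT.
- move=> t; rewrite /= in_itv/= => /C0 Ct; rewrite normrM normrN.
  rewrite !ger0_norm ?expR_ge0 ?invr_ge0 ?(ltW hbeta1)//.
  by rewrite ler_wpM2l ?invr_ge0 ?(ltW hbeta1)// ler_expR gerBl mulr_ge0// ltW.
Qed.

End integrands.

(* The objective with the exponential term replaced by its tangent line at the
   exponent ln eta. *)
Definition tangent (eta : R) (I C : R -> R) (t : R) : R :=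
  eta * (expR (r * (T - t)) * (v * I t - C t))
  - eta * alpha1 * sigma ^+ 2 / 2 * (expR (2 * r * (T - t)) * I t ^+ 2)
  + gamma1 * consumption_utility m t (C t)
  - theta / 2 * (expR (rho * r * (T - t)) * (I t - rational_investment m alpha2 t) ^+ 2).

Lemma tangent_integrable eta I C : admissible m I C ->
  mu.-integrable `[0, T] (EFin \o tangent eta I C).
Proof.
move=> aIC; have i1 := integrableZl mT eta (mean_integrable aIC).
have i2 := integrableZl mT (eta * alpha1 * sigma ^+ 2 / 2) (var_integrable aIC).
have i3 := integrableZl mT gamma1 (consumption_utility_integrable aIC).
have i4 := integrableZl mT (theta / 2) (deviation_integrable aIC).
by have := integrableB mT (integrableD mT (integrableB mT i1 i2) i3) i4; apply: eq_integrable.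
Qed.

Lemma integral_tangent eta I C : admissible m I C ->
  \int[mu]_(t in `[0, T]) tangent eta I C t =
  eta * (fund_mean m I C - fund0 m * expR (r * T)) - eta * alpha1 / 2 * fund_var m I
  + (gamma1 * \int[mu]_(t in `[0, T]) (consumption_utility m t (C t))
     - theta * average_deviation m I (rational_investment m alpha2)).
Proof.
move=> aIC; have i1 := integrableZl mT eta (mean_integrable aIC).
have i2 := integrableZl mT (eta * alpha1 * sigma ^+ 2 / 2) (var_integrable aIC).
have i3 := integrableZl mT gamma1 (consumption_utility_integrable aIC).
have i4 := integrableZl mT (theta / 2) (deviation_integrable aIC).
have i12 := integrableB mT i1 i2; have i123 := integrableD mT i12 i3.
rewrite RintegralB// RintegralD// RintegralB//.
rewrite (RintegralZl _ mT (mean_integrable aIC)) (RintegralZl _ mT (var_integrable aIC)).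
rewrite (RintegralZl _ mT (consumption_utility_integrable aIC)).
rewrite (RintegralZl _ mT (deviation_integrable aIC)).
by rewrite /fund_mean /fund_var /average_deviation; field.
Qed.

(** Convexity in the form e^x >= eta (1 + x - ln eta). After division by alpha1 the right-hand side
    is affine in the mean and the variance, and [integral_tangent] writes it as one integral over
    time. *)
Lemma objective_le_tangent eta I C I' C' : admissible m I C -> admissible m I' C' ->
  eta = expR (exponent I' C') ->
  objective_real I C - objective_real I' C' <=
  \int[mu]_(t in `[0, T]) tangent eta I C t - \int[mu]_(t in `[0, T]) tangent eta I' C' t.
Proof.
move=> a a' etaE; rewrite !integral_tangent// /objective_real -etaE.
have h : eta * (1 + (exponent I C - exponent I' C')) <= expR (exponent I C).
  rewrite -{2}(subrK (exponent I' C') (exponent I C)) expRD -etaE mulrC.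
  by rewrite ler_wpM2r ?etaE ?expR_ge0// expR_ge1Dx.
have {}h := ler_wpM2l (ltW (etrans (invr_gt0 alpha1) halpha1)) h.
rewrite -subr_ge0; set lhs := _ - _.
suff -> : lhs = alpha1^-1 * expR (exponent I C) - alpha1^-1 * (eta * (1 + (exponent I C - exponent I' C'))).
  by rewrite subr_ge0.
by rewrite /lhs /exponent; field; rewrite gt_eqF.
Qed.

Lemma is_derive_rational_investment (a t : R) :
  is_derive t (1 : R) (rational_investment m a) (r * rational_investment m a t).
Proof.
have h := is_deriveZ (v / (a * sigma ^+ 2)) (is_derive_expR_lin (- r) T t).
have -> : rational_investment m a =
    (v / (a * sigma ^+ 2)) \*: (fun u => expR (- r * (T - u))).
  apply/funext => u; rewrite /rational_investment /GRing.scale/=; congr (_ * expR _).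
  by ring.
by apply: is_derive_eq h _; rewrite opprK /= /GRing.scale/=; ring.
Qed.

Section investment.
Variable eta : R.
Hypothesis heta : 0 < eta.

Let u t := expR ((2 - rho) * r * (T - t)).
Let num t := eta * alpha2 * sigma ^+ 2 * u t + theta.
Let den t := eta * alpha1 * sigma ^+ 2 * u t + theta.

Lemma investment_den_gt0 t : 0 < den t.
Proof. by rewrite ltr_wpDr// !mulr_gt0 ?expR_gt0 ?exprn_gt0. Qed.

Let u_derive (t : R) : is_derive t (1 : R) u (- ((2 - rho) * r) * u t).
Proof. exact: is_derive_expR_lin. Qed.

Let lin_derive (a t : R) : is_derive t (1 : R) (fun s => a * u s + theta)
  (a * (- ((2 - rho) * r) * u t)).
Proof.
apply: is_derive_eq (is_deriveD (is_deriveZ a (u_derive t)) (is_derive_cst theta t 1)) _.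
by rewrite addr0.
Qed.

(** The derivative of the candidate, spelled out because [fund_process_exists] asks for a continuous
    one. *)
Definition optimal_investment' t : R :=
  (eta * alpha2 * sigma ^+ 2 * (- ((2 - rho) * r) * u t) / den t
   - num t * (eta * alpha1 * sigma ^+ 2 * (- ((2 - rho) * r) * u t)) * (den t)^-1 ^+ 2
   + r * (num t / den t)) * rational_investment m alpha2 t.

Lemma is_derive_optimal_investment (t : R) :
  is_derive t (1 : R) (optimal_investment m eta) (optimal_investment' t).
Proof.
have den0 : den t != 0 by rewrite gt_eqF// investment_den_gt0.
have dV := is_deriveV den0 (lin_derive (eta * alpha1 * sigma ^+ 2) t).
have dN := lin_derive (eta * alpha2 * sigma ^+ 2) t.
have h := is_deriveM (is_deriveM dN dV) (is_derive_rational_investment alpha2 t).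
apply: is_derive_eq h _; rewrite /optimal_investment' /GRing.scale/= -/(u t) -/(num t) -/(den t).
rewrite (_ : (_ * (fun y : R => (den y)^-1)) t = num t / den t)//.
by field.
Qed.

Let cu : continuous u. Proof. exact: continuous_expR_lin. Qed.

Let clin (a : R) : continuous (fun t => a * u t + theta).
Proof. by move=> t; apply: cvgD; [apply: cvgMr; exact: cu|exact: cvg_cst]. Qed.

Let cdenV : continuous (fun t => (den t)^-1).
Proof. by move=> t; apply: cvgV; [rewrite gt_eqF// investment_den_gt0|exact: clin]. Qed.

Lemma continuous_optimal_investment' : continuous optimal_investment'.
Proof.
have cu' (a : R) : continuous (fun t => a * (- ((2 - rho) * r) * u t)).
  by move=> t; apply: cvgMr; apply: cvgMr; exact: cu.
move=> t; apply: cvgM; last exact: continuous_rational_investment.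
apply: cvgD.
  apply: cvgB; first by apply: cvgM; [exact: cu'|exact: cdenV].
  apply: cvgM; first by apply: cvgM; [exact: clin|exact: cu'].
  under eq_fun do rewrite expr2; rewrite expr2.
  by apply: cvgM; exact: cdenV.
by apply: cvgMr; apply: cvgM; [exact: clin|exact: cdenV].
Qed.

Lemma continuous_optimal_investment : continuous (optimal_investment m eta).
Proof.
move=> t; apply: cvgM; last exact: continuous_rational_investment.
by apply: cvgM; [exact: clin|exact: cdenV].
Qed.

End investment.

Lemma continuous_optimal_consumption k : continuous (optimal_consumption m k).
Proof.
by move=> t; apply: cvgD; [apply: cvgMr; exact: cvg_id|exact: cvg_cst].
Qed.

Lemma optimal_admissible k eta : 0 < eta ->
  (forall t, 0 <= t <= T -> 0 < optimal_consumption m k t) ->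
  admissible m (optimal_investment m eta) (optimal_consumption m k).
Proof.
move=> heta kC; have [mI I2] : square_integrable mu `[0, T] (optimal_investment m eta).
  apply: square_integrable_continuous; apply: continuous_subspaceT.
  exact: continuous_optimal_investment.
split => //; apply: integrable_within_continuous; apply: continuous_subspaceT.
exact: continuous_optimal_consumption.
Qed.

Lemma integral_expR_lin :
  \int[mu]_(t in `[0, T]) expR (r * (T - t)) = (expR (r * T) - 1) / r.
Proof.
have h := Rintegral_expR_lin r T (ltW hT).
rewrite RintegralZl// in h; last first.
  by apply: integrable_within_continuous; exact: within_expR_lin.
by rewrite -[LHS](mulKf hr) h subrr mulr0 expR0 subr0 mulrC.
Qed.

Lemma integral_id_expR_lin :
  \int[mu]_(t in `[0, T]) (r * t * expR (r * (T - t))) = (expR (r * T) - 1 - r * T) / r.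
Proof.
have dF (x : R) : is_derive x (1 : R) (fun t => - (t + r^-1) * expR (r * (T - t)))
    (r * x * expR (r * (T - x))).
  have d1 : is_derive x (1 : R) (fun t : R => - (t + r^-1)) (- (1 + 0)).
    by apply: is_deriveN; apply: is_deriveD.
  apply: is_derive_eq (is_deriveM d1 (is_derive_expR_lin r T x)) _.
  by rewrite /GRing.scale/=; field.
rewrite (Rintegral_is_derive (ltW hT) dF).
  by rewrite subrr mulr0 expR0 subr0; field.
move=> x; apply: cvgM; last exact: continuous_expR_lin.
by apply: cvgMr; exact: cvg_id.
Qed.

Let growth := (expR (r * T) - 1) / r.

(** The rate may be negative; numerator and denominator then change sign together. *)
Lemma growth_gt0 : 0 < growth.
Proof.
rewrite /growth; have [r0|r0] := ltP 0 r.
  by rewrite divr_gt0// subr_gt0 -expR0 ltr_expR mulr_gt0.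
have {r0} r0 : r < 0 by rewrite lt_neqAle hr r0.
by rewrite nmulr_rgt0 ?invr_lt0// subr_lt0 -expR0 ltr_expR nmulr_rlt0.
Qed.

(* - exponent / alpha1 without the term in k *)
Definition certainty_equivalent (eta : R) : R := fund0 m * expR (r * T)
  + \int[mu]_(t in `[0, T]) (v * (expR (r * (T - t)) * optimal_investment m eta t)
     - alpha1 * sigma ^+ 2 / 2 * (expR (2 * r * (T - t)) * optimal_investment m eta t ^+ 2))
  - (1 - rho) / beta1 * ((expR (r * T) - 1 - r * T) / r).

Lemma Rintegral_itv_cst (c : R) : \int[mu]_(t in `[0, T]) c = c * T.
Proof.
have dF (x : R) : is_derive x (1 : R) (fun t => c * t) c.
  by apply: is_derive_eq (is_deriveZ c (is_derive_id x 1)) _; rewrite /GRing.scale/= mulr1.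
by rewrite (Rintegral_is_derive (ltW hT) dF (@cst_continuous _ _ c)) mulr0 subr0.
Qed.

(** * Reformulation of the coupled system *)

Section coupling.
Variable eta : R.
Hypothesis heta : 0 < eta.
Local Notation Iopt := (optimal_investment m eta).

Let within_Iopt : {within `[0, T], continuous Iopt}.
Proof. by apply: continuous_subspaceT; exact: continuous_optimal_investment. Qed.

Let Iopt1 : mu.-integrable `[0, T] (EFin \o (fun t => expR (r * (T - t)) * Iopt t)).
Proof.
apply: integrable_within_continuous; apply: within_continuousM => //; exact: within_expR_lin.
Qed.

Let Iopt2 : mu.-integrable `[0, T] (EFin \o (fun t => expR (2 * r * (T - t)) * Iopt t ^+ 2)).
Proof.
have [_ I2] : square_integrable mu `[0, T] Iopt by exact: square_integrable_continuous.
by apply: (integrable_continuousM _ I2); exact: within_expR_lin.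
Qed.

Let e1 : mu.-integrable `[0, T] (EFin \o (fun t => expR (r * (T - t)))).
Proof. by apply: integrable_within_continuous; exact: within_expR_lin. Qed.

Let e1t : mu.-integrable `[0, T] (EFin \o (fun t => r * t * expR (r * (T - t)))).
Proof.
apply: integrable_within_continuous; apply: within_continuousM; last exact: within_expR_lin.
by apply: continuous_subspaceT => x; apply: cvgMr; exact: cvg_id.
Qed.

Let A := \int[mu]_(t in `[0, T]) (expR (r * (T - t)) * Iopt t).
Let W := \int[mu]_(t in `[0, T]) (expR (2 * r * (T - t)) * Iopt t ^+ 2).

Let ceE : certainty_equivalent eta = fund0 m * expR (r * T) + (v * A - alpha1 * sigma ^+ 2 / 2 * W)
  - (1 - rho) / beta1 * ((expR (r * T) - 1 - r * T) / r).
Proof.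
rewrite /certainty_equivalent; congr (_ + _ - _).
have i1 := integrableZl mT v Iopt1; have i2 := integrableZl mT (alpha1 * sigma ^+ 2 / 2) Iopt2.
by rewrite RintegralB// (RintegralZl _ mT Iopt1) (RintegralZl _ mT Iopt2).
Qed.

Let integral_mean k : \int[mu]_(t in `[0, T]) (expR (r * (T - t)) *
    (v * Iopt t - optimal_consumption m k t)) =
  v * A - (1 - rho) / beta1 * ((expR (r * T) - 1 - r * T) / r) - k * growth.
Proof.
have i1 := integrableZl mT v Iopt1; have i2 := integrableZl mT ((1 - rho) / beta1) e1t.
have i3 := integrableZl mT k e1; have i12 := integrableB mT i1 i2.
rewrite -integral_id_expR_lin -/growth /growth -integral_expR_lin.
rewrite -(RintegralZl _ mT Iopt1) -(RintegralZl _ mT e1t) -(RintegralZl _ mT e1).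
rewrite -RintegralB// -RintegralB//; apply: eq_Rintegral => t _.
by rewrite /optimal_consumption; ring.
Qed.

Lemma optimal_exponentE k : exponent Iopt (optimal_consumption m k) =
  - alpha1 * (certainty_equivalent eta - k * growth).
Proof. by rewrite /exponent /fund_mean /fund_var integral_mean ceE -/W; field; rewrite ?hr ?gt_eqF. Qed.

Lemma eta_formulaE k : eta_formula m k eta = expR (exponent Iopt (optimal_consumption m k)).
Proof. by congr expR; rewrite /exponent /fund_mean /fund_var; ring. Qed.

(** Expanding the square of I_1^* - \bar I_1, the cross term supplies the linear term v A of the
    certainty equivalent, and the square of \bar I_1 cancels v^2 T / (2 alpha1 sigma^2). *)
Lemma k_formulaE : k_formula m eta = (beta1 / alpha1 + growth)^-1 *
  (- (r * T / alpha1) + ln gamma1 / alpha1 + certainty_equivalent eta).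
Proof.
rewrite /k_formula -/growth; congr (_ * _).
have -> : \int[mu]_(t in `[0, T]) (expR (2 * r * (T - t)) *
        (Iopt t - rational_investment m alpha1 t) ^+ 2) =
    W - 2 * v / (alpha1 * sigma ^+ 2) * A + v ^+ 2 / (alpha1 ^+ 2 * sigma ^+ 4) * T.
  have i1 := integrableZl mT (2 * v / (alpha1 * sigma ^+ 2)) Iopt1.
  have i12 := integrableB mT Iopt2 i1.
  have i3 : mu.-integrable `[0, T] (EFin \o (fun=> v ^+ 2 / (alpha1 ^+ 2 * sigma ^+ 4))).
    by apply: integrable_within_continuous; apply: continuous_subspaceT; exact: cst_continuous.
  rewrite -Rintegral_itv_cst -(RintegralZl _ mT Iopt1) -RintegralB// -RintegralD//.
  apply: eq_Rintegral => t _; rewrite /rational_investment.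
  rewrite (_ : r * (t - T) = - (r * (T - t))) ?expRN; last by ring.
  rewrite (_ : 2 * r * (T - t) = r * (T - t) + r * (T - t)) ?expRD; last by ring.
  by field; rewrite !gt_eqF ?expR_gt0.
by rewrite ceE; field; rewrite ?hr ?gt_eqF//= addr_gt0// ?divr_gt0// growth_gt0.
Qed.

End coupling.

(** For a given certainty equivalent both conditions on the right are linear in k and ln eta: the
    first is the first-order condition for consumption, the second the definition of eta. The
    formula for k is what remains after eliminating ln eta between them. *)
Lemma coupled_systemP k eta : coupled_system m k eta <->
  [/\ 0 < eta, beta1 * k = ln gamma1 - ln eta - r * T &
      ln eta = - alpha1 * (certainty_equivalent eta - k * growth)].
Proof.
have Dn : 0 < beta1 / alpha1 + growth by apply: addr_gt0; [exact: divr_gt0|exact: growth_gt0].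
split => [[kE etaE]|[eta0 kE etaE]].
  have eta0 : 0 < eta by rewrite etaE expR_gt0.
  have lnE : ln eta = - alpha1 * (certainty_equivalent eta - k * growth).
    by rewrite {1}etaE eta_formulaE// expRK optimal_exponentE.
  split => //; rewrite lnE.
  have : (beta1 / alpha1 + growth) * k =
      - (r * T / alpha1) + ln gamma1 / alpha1 + certainty_equivalent eta.
    by rewrite {1}kE k_formulaE// mulrA divff ?gt_eqF// mul1r.
  move=> h.
  have -> : certainty_equivalent eta =
      (beta1 / alpha1 + growth) * k + r * T / alpha1 - ln gamma1 / alpha1 by rewrite h; ring.
  by move: growth => g; field; rewrite gt_eqF.
split; last by rewrite eta_formulaE// optimal_exponentE// -[LHS]lnK//; congr expR.
rewrite k_formulaE//; apply: (mulfI (lt0r_neq0 Dn)); rewrite mulrA divff ?gt_eqF// mul1r.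
have -> : certainty_equivalent eta = k * growth - ln eta / alpha1.
  by rewrite etaE; field; rewrite gt_eqF.
have -> : ln gamma1 = beta1 * k + ln eta + r * T by rewrite kE; ring.
by move: growth => g; field; rewrite gt_eqF.
Qed.

(** The fraction is a weighted mean of alpha2 / alpha1 and 1, hence at most their sum, uniformly in
    eta. This yields both the dominating function and the bound on the certainty equivalent. *)
Lemma optimal_investment_le eta t : 0 < eta ->
  `|optimal_investment m eta t| <= (1 + alpha2 / alpha1) * `|rational_investment m alpha2 t|.
Proof.
move=> eta0; rewrite normrM ler_wpM2r//.
set u := expR _; have u0 : 0 < u := expR_gt0 _.
have den0 := investment_den_gt0 eta0 t; rewrite -/u in den0.
rewrite ger0_norm; last first.
  by rewrite divr_ge0 ?(ltW den0)// addr_ge0// !mulr_ge0 ?ltW// exprn_gt0.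
rewrite ler_pdivrMr// mulrDl mul1r.
have -> : alpha2 / alpha1 * (eta * alpha1 * sigma ^+ 2 * u + theta) =
    eta * alpha2 * sigma ^+ 2 * u + alpha2 / alpha1 * theta by field; rewrite gt_eqF.
have h1 : 0 <= eta * alpha1 * sigma ^+ 2 * u by rewrite !mulr_ge0 ?ltW// exprn_gt0.
have h2 : 0 <= alpha2 / alpha1 * theta by rewrite mulr_ge0// divr_ge0 ?ltW.
lra.
Qed.

Let ce_integrand (eta t : R) :=
  v * (expR (r * (T - t)) * optimal_investment m eta t)
     - alpha1 * sigma ^+ 2 / 2 * (expR (2 * r * (T - t)) * optimal_investment m eta t ^+ 2).

Let ce_bound (t : R) := let b := (1 + alpha2 / alpha1) * `|rational_investment m alpha2 t| in
  `|v| * (expR (r * (T - t)) * b) + alpha1 * sigma ^+ 2 / 2 * (expR (2 * r * (T - t)) * b ^+ 2).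

Let ce_integrand_le eta t : 0 < eta -> `|ce_integrand eta t| <= ce_bound t.
Proof.
move=> eta0; have hb := optimal_investment_le t eta0.
apply: le_trans (ler_normB _ _) _; apply: lerD.
  by rewrite 2!normrM (ger0_norm (expR_ge0 _)) ler_wpM2l// ler_wpM2l ?expR_ge0.
have c0 : 0 <= alpha1 * sigma ^+ 2 / 2 by rewrite divr_ge0// mulr_ge0 ?ltW ?exprn_gt0.
rewrite normrM (ger0_norm c0) ler_wpM2l// normrM (ger0_norm (expR_ge0 _)) ler_wpM2l//.
by rewrite normrX lerXn2r ?nnegrE// (le_trans _ hb).
Qed.

Let ce_bound_continuous : continuous ce_bound.
Proof.
have cb : continuous (fun t => (1 + alpha2 / alpha1) * `|rational_investment m alpha2 t|).
  move=> t; apply: cvgMr; apply: cvg_norm; exact: continuous_rational_investment.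
move=> t; apply: cvgD; apply: cvgMr; apply: cvgM.
- exact: continuous_expR_lin.
- exact: cb.
- exact: continuous_expR_lin.
- under eq_fun do rewrite expr2; rewrite expr2; apply: cvgM; exact: cb.
Qed.

Let ce_integrand_continuous (l t : R) : {for l, continuous (fun l => ce_integrand (expR l) t)}.
Proof.
have cI : {for l, continuous (fun l => optimal_investment m (expR l) t)}.
  have clin (a : R) : {for l, continuous (fun l => expR l * a * sigma ^+ 2 *
      expR ((2 - rho) * r * (T - t)) + theta)}.
    apply: cvgD; last exact: cvg_cst.
    by do 3 apply: cvgMl; exact: continuous_expR.
  apply: cvgMl; apply: cvgM; first exact: clin.
  by apply: cvgV; [rewrite gt_eqF// investment_den_gt0// expR_gt0|exact: clin].
apply: cvgB; apply: cvgMr; apply: cvgMr => //.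
by under eq_fun do rewrite expr2; rewrite expr2; apply: cvgM.
Qed.

Let continuous_within_ce_integrand eta : 0 < eta -> {within `[0, T], continuous (ce_integrand eta)}.
Proof.
move=> eta0; have cI := continuous_optimal_investment eta0.
apply: continuous_subspaceT => t; apply: cvgB; apply: cvgMr; apply: cvgM.
- exact: continuous_expR_lin.
- exact: cI.
- exact: continuous_expR_lin.
- under eq_fun do rewrite expr2; rewrite expr2; apply: cvgM; exact: cI.
Qed.

Let ce_bound_integrable : mu.-integrable `[0, T] (EFin \o ce_bound).
Proof. by apply: integrable_within_continuous; exact: continuous_subspaceT. Qed.

Lemma continuous_certainty_equivalent : continuous (fun l => certainty_equivalent (expR l)).
Proof.
move=> l; apply: cvgB; last exact: cvg_cst.
apply: cvgD; first exact: cvg_cst.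
(* Any open interval around [l] would do, as the domination by [ce_bound] is uniform in eta > 0. *)
have : {in (`](l - 1), (l + 1)[%classic : set R), continuous
    (fun l => \int[mu]_(t in `[0, T]) ce_integrand (expR l) t)}.
  apply: (@continuity_under_integral _ _ _ mu (fun l => ce_integrand (expR l)) _ mT (l - 1) (l + 1) _ _ ce_bound) => //.
  - move=> x _; apply: integrable_within_continuous.
    by apply: continuous_within_ce_integrand; exact: expR_gt0.
  - by apply: aeW => t _ x _; exact: ce_integrand_continuous.
  - by move=> x _; apply: aeW => t _; apply: ce_integrand_le; exact: expR_gt0.
by apply; rewrite inE/= in_itv/=; apply/andP; split; lra.
Qed.

Lemma certainty_equivalent_bounded : exists K, forall eta, 0 < eta ->
  `|certainty_equivalent eta| <= K.
Proof.
exists (`|fund0 m * expR (r * T)| + \int[mu]_(t in `[0, T]) ce_bound t +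
  `|(1 - rho) / beta1 * ((expR (r * T) - 1 - r * T) / r)|) => eta eta0.
apply: le_trans (ler_normB _ _) _; apply: lerD => //.
apply: le_trans (ler_normD _ _) _; apply: lerD => //.
have ic := integrable_within_continuous (continuous_within_ce_integrand eta0).
apply: le_trans (le_normr_Rintegral mT ic) _; apply: le_Rintegral => //.
  exact: integrable_norm.
by move=> t _; exact: ce_integrand_le.
Qed.

Lemma coupled_system_exists : exists k eta, coupled_system m k eta.
Proof.
pose kk l := (ln gamma1 - l - r * T) / beta1.
(* With l = ln eta, [kk l] solves the first-order condition for k, and [phi l = 0] is the remaining
   equation of the system. *)
pose phi l := l + alpha1 * (certainty_equivalent (expR l) - kk l * growth).
suff [l phil] : exists l, phi l = 0.
  exists (kk l), (expR l); apply/coupled_systemP; rewrite expRK; split.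
  - exact: expR_gt0.
  - by rewrite /kk mulrC divfK// gt_eqF.
  - by apply/eqP; rewrite -subr_eq0 mulNr opprK; apply/eqP.
have [K hK] := certainty_equivalent_bounded.
pose s := 1 + alpha1 * growth / beta1.
have g0 := growth_gt0.
have ag : 0 < alpha1 * growth / beta1 by apply: divr_gt0 => //; exact: mulr_gt0.
have s1 : 1 <= s by rewrite lerDl ltW.
pose c0 := alpha1 * growth / beta1 * (ln gamma1 - r * T).
have phiE l : phi l = s * l + alpha1 * certainty_equivalent (expR l) - c0.
  by rewrite /phi /kk /s /c0; field; rewrite gt_eqF.
have K0 : 0 <= K by apply: le_trans (hK 1 ltr01).
(* [phi] differs from [s * l] by at most Z, and s >= 1, so it has opposite signs (or zeros) at - Z
   and Z. *)
pose Z := alpha1 * K + `|c0|.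
have Z0 : 0 <= Z by rewrite addr_ge0// mulr_ge0// ltW.
have aK l : `|alpha1 * certainty_equivalent (expR l)| <= alpha1 * K.
  by rewrite normrM (gtr0_norm halpha1) (ler_pM2l halpha1); apply: hK; exact: expR_gt0.
have cphi : continuous phi.
  move=> l; apply: cvgD; first exact: cvg_id.
  apply: cvgMr; apply: cvgB; first exact: continuous_certainty_equivalent.
  apply: cvgMl; apply: cvgMl; apply: cvgB; last exact: cvg_cst.
  by apply: cvgB; [exact: cvg_cst|exact: cvg_id].
have NZZ : - Z <= Z by rewrite ge0_cp.
have lo : phi (- Z) <= 0.
  rewrite phiE; have := aK (- Z); rewrite ler_norml => /andP[_ h].
  have := ler_norm (- c0); rewrite normrN => h2.
  have := ler_wpM2r Z0 s1; rewrite mul1r /Z => h3; lra.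
have hi : 0 <= phi Z.
  rewrite phiE; have := aK Z; rewrite ler_norml => /andP[h _].
  have h2 := ler_norm c0.
  have := ler_wpM2r Z0 s1; rewrite mul1r /Z => h3; lra.
have cw : {within `[- Z, Z], continuous phi} by exact: continuous_subspaceT.
have [|l _ phil] := IVT (v := 0) NZZ cw.
  by rewrite ge_min lo/= le_max hi orbT.
by exists l.
Qed.

(** * Optimality and uniqueness of the candidate *)

Section verification.
Variables (k eta : R).
Hypothesis hke : coupled_system m k eta.
Local Notation Iopt := (optimal_investment m eta).
Local Notation Copt := (optimal_consumption m k).

Let eta0 : 0 < eta. Proof. by have /coupled_systemP[] := hke. Qed.

Let first_order_consumption t :
  gamma1 * expR (- rho * r * t - beta1 * Copt t) = eta * expR (r * (T - t)).
Proof.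
have /coupled_systemP[_ kE _] := hke.
rewrite -[in LHS](lnK hgamma1) -[in RHS](lnK eta0) -!expRD; congr expR.
rewrite /optimal_consumption (_ : beta1 * _ = (1 - rho) * r * t + beta1 * k); last first.
  by field; rewrite gt_eqF.
by rewrite kE; ring.
Qed.

(** The derivative of [tangent] in the investment vanishes at the candidate. Factoring e^(rho r(T -
    t)) out of e^(2r(T - t)) is the origin of the exponent (2 - rho) r (T - t) in I_1^*. *)
Let first_order_investment t :
  eta * v * expR (r * (T - t)) + theta * expR (rho * r * (T - t)) * rational_investment m alpha2 t =
  (eta * alpha1 * sigma ^+ 2 * expR (2 * r * (T - t)) + theta * expR (rho * r * (T - t))) * Iopt t.
Proof.
rewrite /optimal_investment; have := investment_den_gt0 eta0 t.
set u := expR ((2 - rho) * r * (T - t)) => den0; set e := expR (rho * r * (T - t)).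
have -> : expR (2 * r * (T - t)) = u * e by rewrite -expRD; congr expR; ring.
have vE : eta * v * expR (r * (T - t)) =
    eta * alpha2 * sigma ^+ 2 * u * e * rational_investment m alpha2 t.
  have -> : eta * alpha2 * sigma ^+ 2 * u * e = eta * alpha2 * sigma ^+ 2 * (expR (r * (T - t)) ^+ 2).
    by rewrite -mulrA; congr (_ * _); rewrite expr2 -!expRD; congr expR; ring.
  rewrite /rational_investment (_ : r * (t - T) = - (r * (T - t))) ?expRN; last by ring.
  by field; rewrite ?gt_eqF ?expR_gt0.
by rewrite vE; field; rewrite gt_eqF.
Qed.

(** What the tangent functional loses away from its stationary point, exactly: a square in the
    investment, in which it is quadratic, and the convexity gap of the exponential in the
    consumption. *)
Let remainder (I C : R -> R) t : R :=
  2^-1 * (eta * alpha1 * sigma ^+ 2 * expR (2 * r * (T - t)) + theta * expR (rho * r * (T - t))) *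
    (I t - Iopt t) ^+ 2 +
  eta * expR (r * (T - t)) / beta1 *
    (expR (- (beta1 * (C t - Copt t))) - (1 - beta1 * (C t - Copt t))).

Let tangent_gap I C t :
  tangent eta Iopt Copt t - tangent eta I C t = remainder I C t.
Proof.
have foi := first_order_investment t; have foc := first_order_consumption t.
rewrite /tangent /consumption_utility /remainder.
have -> : expR (- rho * r * t - beta1 * C t) =
    expR (- rho * r * t - beta1 * Copt t) * expR (- (beta1 * (C t - Copt t))).
  by rewrite -expRD; congr expR; ring.
move: foi foc; set E2 := expR (2 * r * (T - t)); set E1 := expR (r * (T - t)).
set Er := expR (rho * r * (T - t)); set I2 := rational_investment m alpha2 t.
set EC := expR (- rho * r * t - _); set X := expR (- _).
set i := I t; set is_ := Iopt t; set c := C t; set cs := Copt t => foi foc.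
have -> : gamma1 * (- beta1^-1 * EC) = - beta1^-1 * (gamma1 * EC) by ring.
have -> : gamma1 * (- beta1^-1 * (EC * X)) = - beta1^-1 * (gamma1 * EC) * X by ring.
rewrite foc.
(* Regrouping isolates the left side of the first-order condition for the investment as the
   coefficient of [is_ - i]; once it is replaced, the terms in the investment form a perfect
   square. *)
have -> : eta * (E1 * (v * is_ - cs)) - eta * alpha1 * sigma ^+ 2 / 2 * (E2 * is_ ^+ 2)
      + - beta1^-1 * (eta * E1) - theta / 2 * (Er * (is_ - I2) ^+ 2) -
    (eta * (E1 * (v * i - c)) - eta * alpha1 * sigma ^+ 2 / 2 * (E2 * i ^+ 2)
      + - beta1^-1 * (eta * E1) * X - theta / 2 * (Er * (i - I2) ^+ 2)) =
    (eta * v * E1 + theta * Er * I2) * (is_ - i)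
    - (eta * alpha1 * sigma ^+ 2 * E2 + theta * Er) / 2 * (is_ ^+ 2 - i ^+ 2)
    + eta * E1 / beta1 * (X - (1 - beta1 * (c - cs))).
  by field; rewrite gt_eqF.
by rewrite foi; field; rewrite gt_eqF.
Qed.

Let weight_gt0 t : 0 < 2^-1 * (eta * alpha1 * sigma ^+ 2 * expR (2 * r * (T - t))
  + theta * expR (rho * r * (T - t))).
Proof.
rewrite mulr_gt0// ltr_wpDr//; last by rewrite !mulr_gt0 ?expR_gt0// exprn_gt0.
by rewrite mulr_ge0// expR_ge0.
Qed.

Let exp_gap_ge0 (x : R) : 0 <= expR (- x) - (1 - x).
Proof. by rewrite subr_ge0; exact: expR_ge1Dx. Qed.

Let cweight_gt0 t : 0 < eta * expR (r * (T - t)) / beta1.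
Proof. by rewrite divr_gt0// mulr_gt0// expR_gt0. Qed.

Let remainder_ge0 I C t : 0 <= remainder I C t.
Proof.
apply: addr_ge0; apply: mulr_ge0; rewrite ?sqr_ge0 ?exp_gap_ge0// ltW ?cweight_gt0//.
Qed.

Let remainder_eq0 I C t : remainder I C t = 0 -> I t = Iopt t /\ C t = Copt t.
Proof.
move=> /eqP; rewrite paddr_eq0; last 2 first.
- by rewrite mulr_ge0 ?sqr_ge0// ltW// weight_gt0.
- by rewrite mulr_ge0 ?exp_gap_ge0// ltW// cweight_gt0.
rewrite mulf_eq0 gt_eqF ?weight_gt0//= sqrf_eq0 subr_eq0 => /andP[/eqP -> h].
split => //; move: h; rewrite mulf_eq0 gt_eqF ?cweight_gt0//= => h.
apply/eqP; rewrite -subr_eq0; apply: contraTT h => cne.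
have : - (beta1 * (C t - Copt t)) != 0 by rewrite oppr_eq0 mulf_neq0// gt_eqF.
by move=> /expR_gt1Dx; rewrite -subr_gt0 => /lt0r_neq0.
Qed.

Hypothesis hC : forall t, 0 <= t <= T -> 0 < Copt t.

Let aopt : admissible m Iopt Copt. Proof. exact: optimal_admissible. Qed.

Let etaE : eta = expR (exponent Iopt Copt).
Proof. by case: hke => _; rewrite eta_formulaE. Qed.

Let remainder_integrable I C : admissible m I C ->
  mu.-integrable `[0, T] (EFin \o remainder I C).
Proof.
move=> aIC; have := integrableB mT (tangent_integrable eta aopt) (tangent_integrable eta aIC).
by apply: eq_integrable => // t _ /=; rewrite -EFinB tangent_gap.
Qed.

(** The remainder is kept in the inequality because it serves twice: its sign gives maximality, and
    its vanishing almost everywhere gives uniqueness. *)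
Lemma objective_gap I C : admissible m I C ->
  objective_real I C + \int[mu]_(t in `[0, T]) remainder I C t <= objective_real Iopt Copt.
Proof.
move=> aIC; have := objective_le_tangent aIC aopt etaE.
rewrite -RintegralB//; [|exact: tangent_integrable..].
have -> : \int[mu]_(t in `[0, T]) (tangent eta I C t - tangent eta Iopt Copt t) =
    \int[mu]_(t in `[0, T]) (-1 * remainder I C t).
  by apply: eq_Rintegral => t _; rewrite -tangent_gap; ring.
rewrite (RintegralZl _ mT (remainder_integrable aIC)) => h; lra.
Qed.

Lemma objective_max I C : admissible m I C -> objective_real I C <= objective_real Iopt Copt.
Proof.
move=> aIC; apply: le_trans (objective_gap aIC); rewrite lerDl.
by apply: Rintegral_ge0 => t _; exact: remainder_ge0.
Qed.

Lemma objective_max_unique I C : admissible m I C ->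
  objective_real Iopt Copt <= objective_real I C ->
  {ae mu, forall t, 0 <= t <= T -> I t = Iopt t /\ C t = Copt t}.
Proof.
move=> aIC le; have gap := objective_gap aIC.
have iR := remainder_integrable aIC.
have int0 : \int[mu]_(t in `[0, T]) remainder I C t = 0.
  apply/eqP; rewrite eq_le; apply/andP; split; first by lra.
  by apply: Rintegral_ge0 => t _; exact: remainder_ge0.
have : (\int[mu]_(t in `[0%R, T]) `|(remainder I C t)%:E| = 0)%E.
  have -> : (\int[mu]_(t in `[0%R, T]) `|(remainder I C t)%:E| =
      \int[mu]_(t in `[0%R, T]) (remainder I C t)%:E)%E.
    by apply: eq_integral => t _; rewrite gee0_abs// lee_fin remainder_ge0.
  by rewrite -[LHS]fineK ?integrable_fin_num//; congr (_%:E).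
move/(ae_eq_integral_abs mu mT (measurable_int _ iR)).
apply: filterS => t /= h tT; apply: remainder_eq0; apply: EFin_inj; apply: h.
by rewrite /= in_itv.
Qed.

Section stochastic.
Context d (Omega : measurableType d) (P : probability Omega R).
Variables (F : R -> set (set Omega)) (B : R -> Omega -> R).
Hypothesis hF : complete_filtration P T F.
Hypothesis hB : brownian_motion P T F B.

Lemma objective_value_optimal :
  objective_value m P F B Iopt Copt (objective_real Iopt Copt)%:E.
Proof.
split => //.
have [X fX] := fund_process_exists (m := m) hF hB (ltW hT) (is_derive_optimal_investment eta0)
  (continuous_optimal_investment' eta0) (continuous_optimal_consumption (k := k)).
by exists X => //; rewrite (objectiveE hF hB aopt fX).
Qed.

Lemma objective_valueE I C J : objective_value m P F B I C J ->
  J = (objective_real I C)%:E.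
Proof. by move=> [aIC [X fX ->]]; exact: (objectiveE hF hB aIC fX). Qed.

Lemma optimal_decision : optimal m P F B Iopt Copt.
Proof.
exists (objective_real Iopt Copt)%:E; first exact: objective_value_optimal.
move=> I C J vJ; rewrite (objective_valueE vJ) lee_fin.
by apply: objective_max; case: vJ.
Qed.

Lemma optimal_decision_unique I C : optimal m P F B I C ->
  {ae mu, forall t, 0 <= t <= T -> I t = Iopt t /\ C t = Copt t}.
Proof.
move=> [J vJ maxJ]; apply: objective_max_unique; first by case: vJ.
have := maxJ _ _ _ objective_value_optimal.
by rewrite (objective_valueE vJ) lee_fin.
Qed.

End stochastic.
End verification.
End optimality.

Theorem theorem2 (R : realType) (d : measure_display) (Omega : measurableType d)
    (P : probability Omega R) (m : model R)
    (F : R -> set (set Omega)) (B : R -> Omega -> R)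
    (hr : rate m != 0) (hsigma : 0 < volatility m) (hT : 0 < horizon m)
    (halpha1 : 0 < risk1 m) (halpha2 : 0 < risk2 m) (hbeta1 : 0 < diminish m)
    (hgamma1 : 0 < weight m) (hrho : 0 < decay m) (htheta : 0 <= herd m)
    (hF : complete_filtration P (horizon m) F)
    (hB : brownian_motion P (horizon m) F B) :
  (exists k eta : R, coupled_system m k eta) /\
  (forall k eta : R, coupled_system m k eta ->
     (forall t, 0 <= t <= horizon m -> 0 < optimal_consumption m k t) ->
     optimal m P F B (optimal_investment m eta) (optimal_consumption m k) /\
     (forall I1 C1 : R -> R, optimal m P F B I1 C1 ->
        {ae @lebesgue_measure R, forall t, 0 <= t <= horizon m ->
           I1 t = optimal_investment m eta t /\
           C1 t = optimal_consumption m k t})).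
Proof.
split; first exact: coupled_system_exists.
move=> k eta hke hC; split; first exact: optimal_decision.
by move=> I1 C1; exact: optimal_decision_unique.
Qed.
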